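(* For $i = 1, \ldots, d$, let $X_i$ be a compact metric space and let $\mu_i$ be an $s_i$-regular Borel probability measure on $X_i$. Let $\mu = \mu_1 \times \cdots \times \mu_d$ be the product measure on $X_1^d = X_1 \times \cdots \times X_d$, and let $s = (s_1, \ldots, s_d)$. Let $\underline{r} = (r_n)_{n \in \mathbf{N}}$ be a sequence of $d$-tuples $r_n = (r_{n,1}, \ldots, r_{n,d})$ of positive numbers. Then for $\mathbf{P}_\mu$-almost every $\omega = (\omega_n) \in (X_1^d)^{\mathbf{N}}$, $$\dim_{\mathrm H}\Big( \limsup_n \overline{R}(\omega_n, r_n) \Big) = \min\left( \inf\Big\{ t;\ \sum_n \Phi_{r_n}^s(t) < \infty \Big\},\ s_1 + \ldots + s_d \right).$$
   Context: The product $X_1^d = X_1 \times \cdots \times X_d$ of metric spaces $(X_i, d_i)$ carries the metric $d(x, \tilde x) = \max_{1 \le i \le d} d_i(x_i, \tilde x_i)$; $\dim_{\mathrm H}$ is Hausdorff dimension. The closed rectangle with centre $x = (x_1, \ldots, x_d) \in X_1^d$ and side radii $r = (r_1, \ldots, r_d)$ is $\overline{R}(x, r) = \overline{B}(x_1, r_1) \times \cdots \times \overline{B}(x_d, r_d)$, where $\overline{B}(x_i, r_i)$ is the closed ball in $X_i$ with centre $x_i$ and radius $r_i$; $B(x,r)$ denotes an open ball. For sets $A_n$, $\limsup_n A_n = \bigcap_{n=1}^\infty \bigcup_{k=n}^\infty A_k$. $\mathbf{P}_\mu = \mu^{\mathbf{N}}$ is the product probability measure on $\Omega = (X_1^d)^{\mathbf{N}}$,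 so that the points $\omega_n \in X_1^d$ are independent with distribution $\mu$. A Borel measure $\mu$ on a metric space $X$ is $s$-regular (with $s \ge 0$) if there is a constant $c \ge 1$ such that $c^{-1} r^s \le \mu(B(x, r)) \le c r^s$ for every $x \in X$ and $r \in [0, 2|X|]$, where $|X|$ is the diameter of $X$. Singular value function: for $r = (r_1, \ldots, r_d)$ and $s = (s_1, \ldots, s_d)$ with $r_i > 0$ and $s_i \ge 0$, let $\tau$ be a permutation of $\{1, \ldots, d\}$ with $r_{\tau(1)} \ge \ldots \ge r_{\tau(d)}$. Then $\Phi_r^s$ is defined on $[0, s_1 + \ldots + s_d]$ by $$\Phi_r^s(t) = r_{\tau(i)}^{\,t - \sum_{j=1}^{i-1} s_{\tau(j)}} \cdot \prod_{j=1}^{i-1} r_{\tau(j)}^{s_{\tau(j)}} \quad \text{for } t \in [s_{\tau(1)} + \ldots + s_{\tau(i-1)},\ s_{\tau(1)} + \ldots + s_{\tau(i)}].$$ The infimum is over $t$ in the domain of $\Phi$, and the infimum of the empty set is $\infty$.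
   Formalization: The side radii r_{n,i} are assumed bounded by a common constant, and X_i is assumed to have positive diameter whenever s_i > 0; without either assumption the claim is false (e.g. r_n = (2^n, 4^{-n}) on [0,1]^2, or a one-point space regarded as 1-regular). *)

(* Defs.v *)
From HB Require Import structures.
From mathcomp Require Import all_boot all_order all_algebra all_fingroup finmap.
From mathcomp Require Import all_classical all_reals all_analysis.

Set Implicit Arguments.
Unset Strict Implicit.
Unset Printing Implicit Defensive.

Import Order.TTheory GRing.Theory Num.Theory.

Local Open Scope classical_set_scope.
Local Open Scope ring_scope.

(* Measurable types are pointed in the library; a space carrying a probability
   measure is nonempty, so the base point is no restriction. *)
#[short(type="pointedMetricType")]
HB.structure Definition PointedMetric (R : numDomainType) :=
  {M of Metric R M & Pointed M}.

Section MetricNotions.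
Context {R : realType} {T : metricType R}.
Implicit Types (A : set T) (t : R).

Definition diam A : \bar R :=
  ereal_sup [set (mdist p.1 p.2)%:E | p in A `*` A].

(* The empty set has gauge 0 for every t, t = 0 included, whereas a singleton
   has gauge 0 `^ t, which is 1 when t = 0: thus the 0-dimensional measure
   counts points. *)
Definition gauge t A : \bar R :=
  if `[< A = set0 >] then 0%E else (diam A `^ t)%E.

Definition hausdorff_premeasure t (delta : R) A : \bar R :=
  ereal_inf [set (\sum_(0 <= k <oo) gauge t (U k))%E | U in
    [set U : (set T)^nat | (forall k, (diam (U k) <= delta%:E)%E) /\
                           A `<=` \bigcup_k U k]].

Definition hausdorff_measure t A : \bar R :=
  ereal_sup [set hausdorff_premeasure t delta A |
             delta in [set delta : R | 0 < delta]].

Definition hausdorff_dim A : \bar R :=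
  ereal_inf [set t%:E | t in
    [set t : R | 0 <= t /\ hausdorff_measure t A = 0%E]].

End MetricNotions.

Definition borelType (T : topologicalType) := g_sigma_algebraType (@open T).

HB.instance Definition _ (R : numDomainType) (X : pointedMetricType R) :=
  Measurable.copy (borelType X) (g_sigma_algebraType (@open X)).

(* In the library, ball x r is the open ball [set y | mdist x y < r].  The radius
   r = 0 is left out: for s > 0 the bounds hold trivially there, and for s = 0
   they would read c^-1 * 0 `^ 0 <= 0, where 0 `^ 0 = 1. *)
Definition regular_measure {R : realType} (X : pointedMetricType R)
    (mu : probability (borelType X) R) (s : R) : Prop :=
  0 <= s /\ exists c : R, 1 <= c /\
    forall (x : X) (r : R), 0 < r -> (r%:E <= 2%:E * diam [set: X])%E ->
      ((c^-1 * r `^ s)%:E <= mu (ball x r) <= (c * r `^ s)%:E)%E.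

Section ProductMetric.
Context {R : realType} {I : finType}.

Definition metric_prod (X : I -> metricType R) : Type := forall i, X i.

Variable X : I -> metricType R.

Definition prod_dist (x y : metric_prod X) : R :=
  \big[Num.max/0]_i mdist (x i) (y i).

Lemma prod_dist_le (x y : metric_prod X) (e : R) : 0 <= e ->
  prod_dist x y <= e <-> forall i, mdist (x i) (y i) <= e.
Proof.
move=> e0; split=> [+ i|h]; last exact/bigmax_leP.
by move=> /bigmax_leP[_ /(_ i isT)].
Qed.

Lemma prod_dist_ge0 (x y : metric_prod X) : 0 <= prod_dist x y.
Proof. exact: bigmax_ge_id. Qed.

Lemma prod_distxx (x : metric_prod X) : prod_dist x x = 0.
Proof.
apply/eqP; rewrite eq_le prod_dist_ge0 andbT.
by apply/prod_dist_le => // i; rewrite mdistxx.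
Qed.

Lemma prod_dist_eq0 (x y : metric_prod X) : prod_dist x y = 0 -> x = y.
Proof.
move=> xy; apply: functional_extensionality_dep => i; apply: mdist_positivity.
apply/eqP; rewrite eq_le mdist_ge0 andbT.
by move: i; apply/(prod_dist_le x y (lexx 0)); rewrite xy.
Qed.

Lemma prod_dist_sym (x y : metric_prod X) : prod_dist x y = prod_dist y x.
Proof. by apply: eq_bigr => i _; rewrite metric_sym. Qed.

Lemma prod_dist_triangle (y x z : metric_prod X) :
  prod_dist x z <= prod_dist x y + prod_dist y z.
Proof.
apply/prod_dist_le => [|i]; first by rewrite addr_ge0 ?prod_dist_ge0.
apply: (le_trans (metric_triangle _ (y i) _)).
apply: lerD; move: i; apply/prod_dist_le => //; exact: prod_dist_ge0.
Qed.

HB.instance Definition _ := Choice.copy (metric_prod X) (forall i, X i).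
HB.instance Definition _ := @isMetric.Build R (metric_prod X) prod_dist
  prod_distxx prod_dist_eq0 prod_dist_sym prod_dist_triangle.

Definition closed_rectangle (x : metric_prod X) (r : I -> R) :
    set (metric_prod X) :=
  [set y | forall i, mdist (x i) (y i) <= r i].

End ProductMetric.

Section ProductMeasure.
Context {I : choiceType} {d : I -> measure_display}.
Variable T : forall i, measurableType (d i).

Definition coordinate_sets : set (set (forall i, T i)) :=
  [set C | exists i (A : set (T i)), measurable A /\ C = [set x | A (x i)]].

Definition product_space := g_sigma_algebraType coordinate_sets.

HB.instance Definition _ :=
  Measurable.copy product_space (g_sigma_algebraType coordinate_sets).

(* The product measure is the unique P with this property (Dynkin's lemma); it
   exists for every family of probability measures, finite or infinite.  In
   particular the coordinates are independent under P with distributions m i. *)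
Definition is_product_measure {R : realType}
    (m : forall i, probability (T i) R) (P : probability product_space R) :
    Prop :=
  forall (J : {fset I}) (A : forall i, set (T i)),
    (forall i, measurable (A i)) ->
    P [set x | forall i, i \in J -> A i (x i)] =
      (\prod_(i <- J) m i (A i))%E.

End ProductMeasure.

Section SingularValueFunction.
Context {R : realType} {d : nat}.
Implicit Types (r s : 'I_d -> R) (tau : 'S_d).

Definition nonincreasing_along r tau : bool :=
  [forall i : 'I_d, forall j : 'I_d,
     (i <= j)%N ==> (r (tau j) <= r (tau i))].

Definition exponent_sum s tau (k : nat) : R :=
  \sum_(j < d | (j < k)%N) s (tau j).

(* The value does not depend on the sorting permutation tau nor on the interval
   index i that are picked, and such a pair exists when d > 0 and
   0 <= t <= \sum_i s i; outside this domain the value is junk. *)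
Definition singular_value r s (t : R) : R :=
  if [pick p : 'S_d * 'I_d |
       [&& nonincreasing_along r p.1,
           exponent_sum s p.1 p.2 <= t
         & t <= exponent_sum s p.1 p.2.+1]] is Some (tau, i)
  then r (tau i) `^ (t - exponent_sum s tau i) *
       \prod_(j < d | (j < i)%N) r (tau j) `^ s (tau j)
  else 0.

(* Infimum of the empty set is +oo. *)
Definition critical_exponent (r : nat -> 'I_d -> R) s : \bar R :=
  ereal_inf [set t%:E | t in
    [set t : R | 0 <= t <= \sum_i s i /\
       (\sum_(0 <= n <oo) (singular_value (r n) s t)%:E < +oo)%E]].

End SingularValueFunction.

(* Main.v *)
Require Import Defs.
From mathcomp Require Import all_boot all_order all_algebra all_fingroup finmap.
From mathcomp Require Import all_classical all_reals all_analysis.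
From mathcomp Require Import ring lra zify.

(* Write F_r(rho) = prod_i max(r_i, rho)^(s_i) * rho^(t - sum_i s_i).  A packing
   argument shows that F_r(rho) is, up to a constant, the cost of covering a
   rectangle with side radii r by balls of radius rho, and Phi_r(t) is the
   minimum of F_r.  Covering the tail of the sequence of rectangles this way
   gives the upper bound, for every omega.

   For the lower bound let t' < t with sum_n Phi_n(t) = oo.  Cut the indices
   into finite blocks with large sums W_j of Phi_n(t), and consider the random
   densities f_J = prod_(j < J) g_j, where g_j(x) is the sum over the block of
   (Phi_n(t) / W_j) 1[x in R_n] / mu(R(x, r_n)).  They have mean 1, and by
   independence E f_J(x) f_J(y) <= prod_(j < J) (1 + h_j(x, y)), where the
   integral of h_j against the t'-energy kernel is of order 1 / W_j.  Hence, with
   probability close to 1, for infinitely many J the density f_J has mass at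
   least 1/2 and bounded t'-energy, which bounds from below the t'-content of
   the compact set of points lying in some rectangle of each block j < J.  To
   avoid integration over the space, mu is replaced at stage J by the uniform
   measure on a net finer than all the rectangles involved. *)

Set Implicit Arguments.
Unset Strict Implicit.
Unset Printing Implicit Defensive.

Import Order.TTheory GRing.Theory Num.Theory.

Local Open Scope classical_set_scope.
Local Open Scope ring_scope.

(** A block costs only 1 / W_j because distinct indices are independent: only the terms n = m of E
    g_j(x) g_j(y) can exceed the product of the means. Such a term carries Phi_n(t)^2 / W_j^2, and
    one factor Phi_n(t) is cancelled by the kernel integral over the rectangle, which is of order
    mu(R_n) / Phi_n(t). The reason is the identity min(r_i, rho) max(r_i, rho) = r_i rho: the mass
    of a ball of radius rho inside the rectangle, times F_r(rho), is of order mu(R_n) rho^t, and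
    F_r(rho) >= Phi_r(t). Summed over dyadic rho against rho^(-t'), this is a geometric series
    because t' < t.

    The h_j need not be small uniformly in x and y. Those of earlier blocks are bounded, though, by
    a constant known before block j is chosen, and W_j is taken large enough to beat it.

    No limit measure is built. A cheap cover of the limsup set yields, by compactness, finitely many
    balls that cover the points lying in the first J blocks for every large J, so a single late J
    with bounded energy contradicts it. *)

Definition vol {R : realType} {I : finType} (s w : I -> R) : R :=
  \prod_i w i `^ s i.

Lemma prod_powR_const {R : realType} {I : finType} (P : pred I) (s : I -> R)
    (a : R) : 0 < a -> \prod_(i | P i) a `^ s i = a `^ (\sum_(i | P i) s i).
Proof.
move=> a0; elim/big_rec2: _ => [|i x y _ ->]; first by rewrite powRr0.
by rewrite powRD// (gt_eqF a0) implybT.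
Qed.

Lemma sorting_perm {R : realType} {d : nat} (r : 'I_d -> R) :
  exists tau : 'S_d, nonincreasing_along r tau.
Proof.
pose tr : seq R := [tuple r i | i < d].
have : perm_eq (sort (fun x y => y <= x) tr) [tuple r i | i < d].
  by rewrite perm_sort.
move=> /tuple_permP[tau htau]; exists tau.
apply/forallP => i; apply/forallP => j; apply/implyP => ij.
have srt : sorted (fun x y => y <= x) (sort (fun x y : R => y <= x) tr).
  by apply: sort_sorted => x y; exact: le_total.
have rE (k : 'I_d) : nth 0 (sort (fun x y => y <= x) tr) k = r (tau k).
  rewrite htau (nth_map k) ?size_enum_ord// nth_ord_enum.
  by rewrite tnth_mktuple.
have := @sorted_leq_nth _ _ _ _ 0 _ srt i j.
rewrite !inE size_sort size_tuple !rE => -> //.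
by move=> x y z /= xy yz; exact: le_trans yz xy.
Qed.

(** * The singular value function as a minimum of covering costs *)

Section SingularValueBounds.
Context {R : realType} {d : nat}.
Implicit Types (r s : 'I_d -> R) (tau : 'S_d) (t rho : R).

(* Up to a constant, [sum diam^t] for a cover of a rectangle with side radii
   [r] by balls of radius [rho]. *)
Definition covering_cost r s t rho : R :=
  vol s (fun i => Num.max (r i) rho) * rho `^ (t - \sum_i s i).

Lemma exponent_sumT s tau : exponent_sum s tau d = \sum_i s i.
Proof.
rewrite /exponent_sum [RHS](reindex_inj (@perm_inj _ tau))/=.
by apply: eq_bigl => i; rewrite ltn_ord.
Qed.

Lemma exponent_sumS s tau (i : 'I_d) :
  exponent_sum s tau i.+1 = exponent_sum s tau i + s (tau i).
Proof.
rewrite /exponent_sum (bigD1 i)//= addrC; congr (_ + _).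
by apply: eq_bigl => j; rewrite ltnS andbC ltn_neqAle.
Qed.

(** For a sorting [tau], the least [k] with [t <= exponent_sum s tau k.+1] is a valid index:
    minimality, or [0 <= t] if [k = 0], gives the other inequality. So the choice in
    [singular_value] never falls through to its junk value. *)
Lemma singular_value_pick r s t : (0 < d)%N -> (forall i, 0 <= s i) ->
  0 <= t <= \sum_i s i ->
  exists tau (i : 'I_d), [/\ nonincreasing_along r tau,
    exponent_sum s tau i <= t, t <= exponent_sum s tau i.+1 &
    singular_value r s t = r (tau i) `^ (t - exponent_sum s tau i) *
       \prod_(j < d | (j < i)%N) r (tau j) `^ s (tau j)].
Proof.
move=> d0 s0 /andP[t0 tS]; rewrite /singular_value.
case: pickP => [[tau i]/= /and3P[h1 h2 h3]|none]; first by exists tau, i.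
exfalso; have [tau htau] := sorting_perm r.
have : exists k, (k < d)%N && (t <= exponent_sum s tau k.+1).
  by exists d.-1; rewrite ltn_predL d0/= prednK// exponent_sumT.
case/ex_minnP => k /andP[kd tk] kmin.
have /= := none (tau, Ordinal kd); rewrite htau tk andbT/=.
move/negbT; rewrite -ltNge => tlt.
case: k kd tk kmin tlt => [|k] kd tk kmin tlt.
  move: tlt; rewrite /exponent_sum big_pred0//.
  by rewrite ltNge t0.
have := kmin k; rewrite (ltnW kd) (ltW tlt)/= => /(_ isT).
by rewrite ltnn.
Qed.

Lemma split_at s r tau (i : 'I_d) :
  vol s r = (\prod_(j < d | (j < i)%N) r (tau j) `^ s (tau j)) *
            \prod_(j < d | (i <= j)%N) r (tau j) `^ s (tau j).
Proof.
rewrite /vol [LHS](reindex_inj (@perm_inj _ tau))/= (bigID (fun j : 'I_d => j <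
  i)%N)/=.
by congr (_ * _); apply: eq_bigl => j; rewrite -leqNgt.
Qed.

Lemma sum_split_at s tau (i : nat) :
  \sum_i s i = exponent_sum s tau i + \sum_(j < d | (i <= j)%N) s (tau j).
Proof.
rewrite [LHS](reindex_inj (@perm_inj _ tau))/= (bigID (fun j : 'I_d => j < i)%N)/=.
by congr (_ + _); apply: eq_bigl => j; rewrite -leqNgt.
Qed.

Variables (r s : 'I_d -> R) (t : R).
Hypothesis d_gt0 : (0 < d)%N.
Hypothesis r_gt0 : forall i, 0 < r i.
Hypothesis s_ge0 : forall i, 0 <= s i.
Hypothesis t_dom : 0 <= t <= \sum_i s i.

(** At [rho = r (tau i)] the maximum is [r (tau j)] for [j < i] and [rho] for [j >= i], so the
    powers of [rho] collect to the exponent [t - exponent_sum s tau i]. *)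
Lemma singular_value_cost :
  exists i, singular_value r s t = covering_cost r s t (r i).
Proof.
have [tau [i [/forallP srt ti it ->]]] := singular_value_pick r d_gt0 s_ge0 t_dom.
have {}srt (j k : 'I_d) : (j <= k)%N -> r (tau k) <= r (tau j).
  by move/forallP : (srt j) => /(_ k) /implyP.
exists (tau i); rewrite /covering_cost (split_at _ _ tau i) mulrC -mulrA.
congr (_ * _).
  by apply: eq_bigr => j ji; rewrite max_l// srt// ltnW.
rewrite (eq_bigr (fun j => r (tau i) `^ s (tau j))); last first.
  by move=> j ij; rewrite max_r// srt.
rewrite prod_powR_const// -powRD ?(gt_eqF (r_gt0 _)) ?implybT//.
by congr (_ `^ _); rewrite (sum_split_at s tau i); ring.
Qed.

(** Each maximum is bounded below by the suitable one of its two arguments. Before [i] this is the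
    side radius. If [r (tau i) <= rho], the other factors become [rho], which is left with the
    exponent [t - exponent_sum s tau i >= 0]. Otherwise position [i] keeps [r (tau i)], and [rho] is
    left with [t - exponent_sum s tau i.+1 <= 0]. *)
Lemma singular_value_le rho : 0 < rho ->
  singular_value r s t <= covering_cost r s t rho.
Proof.
move=> rho0.
have [tau [i [/forallP srt ti it ->]]] := singular_value_pick r d_gt0 s_ge0 t_dom.
have {}srt (j k : 'I_d) : (j <= k)%N -> r (tau k) <= r (tau j).
  by move/forallP : (srt j) => /(_ k) /implyP.
have powneq (a b : R) : (r (tau i) == 0) = false by rewrite gt_eqF.
have rhoneq : (rho == 0) = false by rewrite gt_eqF.
have max0 j : 0 < Num.max (r j) rho by rewrite lt_max rho0 orbT.
have ge0p (Q : pred 'I_d) (u : 'I_d -> R) :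
    0 <= \prod_(j < d | Q j) u j `^ s (tau j).
  by apply: prodr_ge0 => j _; exact: powR_ge0.
have lep (Q : pred 'I_d) (u v : 'I_d -> R) :
    (forall j, Q j -> 0 < u j <= v j) ->
    \prod_(j < d | Q j) u j `^ s (tau j) <= \prod_(j < d | Q j) v j `^ s (tau j).
  move=> uv; apply: ler_prod => j Qj; rewrite powR_ge0/=.
  have /andP[u0 uvj] := uv _ Qj.
  by apply: ge0_ler_powR => //; rewrite nnegrE ?ltW// (lt_le_trans u0).
rewrite /covering_cost (split_at _ _ tau i) mulrC -mulrA.
apply: (@le_trans _ _ ((\prod_(j < d | (j < i)%N) r (tau j) `^ s (tau j)) *
   ((\prod_(j < d | (i <= j)%N) Num.max (r (tau j)) rho `^ s (tau j)) *
       rho `^ (t - \sum_i s i)))); last first.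
  apply: ler_wpM2r; first by rewrite mulr_ge0// powR_ge0.
  by apply: lep => j _; rewrite r_gt0 le_max lexx.
apply: ler_wpM2l => //.
have [rle|rlt] := leP (r (tau i)) rho.
  apply: (@le_trans _ _ ((\prod_(j < d | (i <= j)%N) rho `^ s (tau j)) *
       rho `^ (t - \sum_i s i))); last first.
    apply: ler_wpM2r; first exact: powR_ge0.
    by apply: lep => j _; rewrite rho0 le_max lexx orbT.
  rewrite prod_powR_const// -powRD ?rhoneq ?implybT//.
  rewrite (_ : _ + _ = t - exponent_sum s tau i); last first.
    by rewrite (sum_split_at s tau i); ring.
  apply: ge0_ler_powR; rewrite ?subr_ge0// nnegrE ltW//.
rewrite (bigD1 i)//=.
apply: (@le_trans _ _ (r (tau i) `^ s (tau i) *
   (\prod_(j < d | (i <= j)%N && (j != i)) rho `^ s (tau j)) *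
       rho `^ (t - \sum_i s i))); last first.
  apply: ler_wpM2r; first exact: powR_ge0.
  apply: ler_pM; rewrite ?powR_ge0//.
    by apply: ge0_ler_powR; rewrite ?nnegrE ?le_max ?lexx// ltW.
  by apply: lep => j _; rewrite rho0 le_max lexx orbT.
rewrite prod_powR_const// -mulrA -powRD ?rhoneq ?implybT//.
have -> : \sum_(i0 < d | (i <= i0)%N && (i0 != i)) s (tau i0) +
    (t - \sum_i s i) = t - exponent_sum s tau i.+1.
  rewrite (sum_split_at s tau i) exponent_sumS [in RHS]addrC.
  rewrite [X in _ - (_ + X)](bigD1 i)//=; ring.
have -> : t - exponent_sum s tau i = s (tau i) + (t - exponent_sum s tau i.+1).
  by rewrite exponent_sumS; ring.
rewrite powRD ?(powneq 0 0) ?implybT//.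
apply: ler_wpM2l; first exact: powR_ge0.
set e := t - _; have e0 : e <= 0 by rewrite subr_le0.
rewrite -[e]opprK !(powRN _ (- e)) lef_pV2 ?posrE ?powR_gt0//.
by apply: ge0_ler_powR; rewrite ?nnegrE ?oppr_ge0// ltW.
Qed.

Lemma singular_value_gt0 : 0 < singular_value r s t.
Proof.
have [i ->] := singular_value_cost.
rewrite mulr_gt0 ?powR_gt0// /vol prodr_gt0// => j _.
by rewrite powR_gt0// lt_max r_gt0.
Qed.

End SingularValueBounds.

(** * The product metric: compactness and bounded distances *)

Lemma mdist_closed_rectangle {R : realType} {I : finType}
    (X : I -> metricType R) (x y : metric_prod X) (e : R) : 0 <= e ->
  mdist x y <= e <-> closed_rectangle x (fun=> e) y.
Proof. exact: prod_dist_le. Qed.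

(** Tychonoff's theorem concerns the product topology; the identity from it to the maximum metric is
    continuous because [I] is finite. *)
Lemma compact_metric_prod {R : realType} {I : finType}
    (X : I -> metricType R) :
  (forall i, compact [set: X i]) -> compact [set: metric_prod X].
Proof.
move=> cX; have := tychonoff cX.
set A := [set f | _] => cA.
have -> : [set: metric_prod X] = (fun f : prod_topology X => f : metric_prod X)
  @` A.
  by apply/seteqP; split => // f _; exists f.
suff ct : forall f : prod_topology X,
    (fun g : prod_topology X => g : metric_prod X) @ f --> (f : metric_prod X).
  apply: (@continuous_compact (prod_topology X) (metric_prod X)) => //.
  by apply: continuous_subspaceT => f; exact: ct.
move=> f; have FF : Filter (nbhs f) by exact: nbhs_filter.
apply/(@metricType_numDomainType.cvgrPdist_lt _ _ _ _ FF) => e e0.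
have : \forall g \near f, forall i, mdist (f i) (g i) < e.
  apply: (@filter_forall _ _ (fun i g => mdist (f i) (g i) < e) _ FF) => i.
  apply: (@metricType_numDomainType.cvgr_dist_lt _ _ _ _ FF) => //.
  exact: (@proj_continuous _ X i f).
apply: filterS => g fg.
by rewrite /mdist/=; apply/bigmax_ltP.
Qed.

Lemma compact_mdist_bounded {R : realType} (X : pointedMetricType R) :
  compact [set: X] -> exists D : R, forall x y : X, mdist x y <= D.
Proof.
rewrite compact_cover => /(_ nat setT (fun n => [set y : X | mdist point y <
  n%:R])).
case.
- move=> n _; rewrite openE => y /= yn; rewrite /interior.
  apply/metricType_numDomainType.nbhs_mdistP; exists (n%:R - mdist point y);
    first by rewrite /= subr_gt0.
  by move=> z /= yz; rewrite (le_lt_trans (metric_triangle _ y _))// -ltrBrDl.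
- move=> y _; have [n ny] : exists n : nat, mdist (point : X) y < n%:R.
    by exists (Num.trunc (mdist point y)).+1; rewrite truncnS_gt.
  by exists n.
(* The sum of the finitely many radii stands in for their maximum. *)
- move=> F _ FX; pose B := \sum_(n <- F) n%:R : R.
  have pB (y : X) : mdist point y <= B.
    have [n /= nF yn] := FX y I; apply: (le_trans (ltW yn)).
    rewrite /B (big_rem n)//= lerDl; apply: sumr_ge0 => k _; exact: ler0n.
  exists (B + B) => x y; apply: (le_trans (metric_triangle _ point _)).
  by rewrite lerD// metric_sym.
Qed.

(** * Separated sets and nets *)

Section SeparatedSets.
Context {R : realType} {T : metricType R}.
Implicit Types (rho : R) (Z : seq T) (A : set T).

Definition dist_separated rho Z := uniq Z /\
  forall x y, x \in Z -> y \in Z -> x != y -> rho <= mdist x y.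

(** A separated subset of largest size is a net: a point farther than [rho] from all its elements
    could be added. *)
Lemma maximal_separated rho A (N : nat) : 0 <= rho ->
  (forall Z, dist_separated rho Z -> (forall z, z \in Z -> A z) -> (size Z <=
    N)%N) ->
  exists Z, [/\ dist_separated rho Z, forall z, z \in Z -> A z &
    forall y, A y -> exists2 z, z \in Z & mdist z y <= rho].
Proof.
move=> rho0 bnd.
pose Q k := `[< exists Z, [/\ dist_separated rho Z, forall z, z \in Z -> A z &
  size Z = k] >].
have exQ : exists k, Q k by exists 0%N; apply/asboolP; exists [::].
have Qle k : Q k -> (k <= N)%N.
  by move=> /asboolP[Z [sZ ZA <-]]; exact: bnd.
case: (ex_maxnP exQ Qle) => k /asboolP[Z [[uZ sZ] ZA sk]] kmax.
exists Z; split => // y Ay; apply: contrapT => noz.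
have far z : z \in Z -> rho < mdist z y.
  by move=> zZ; rewrite ltNge; apply/negP => zy; apply: noz; exists z.
have [/far|yZ] := boolP (y \in Z); first by rewrite mdistxx ltNge rho0.
suff : Q k.+1 by move=> /kmax; rewrite ltnn.
apply/asboolP; exists (y :: Z); split => [|z|]; last by rewrite /= sk.
- split; first by rewrite /= yZ.
  move=> a b; rewrite !inE => /orP[/eqP->|aZ] /orP[/eqP->|bZ].
  + by rewrite eqxx.
  + by move=> _; rewrite metric_sym ltW// far.
  + by move=> _; rewrite ltW// far.
  + exact: sZ.
- by rewrite inE => /orP[/eqP->|/ZA].
Qed.

End SeparatedSets.

(** * Regularity on an enlarged range of radii *)

Section BallMeasure.
Context {R : realType}.
Implicit Type X : pointedMetricType R.

Lemma measurable_ball X (x : X) (w : R) :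
  measurable (ball x w : set (borelType X)).
Proof.
apply: sub_sigma_algebra; rewrite ballEmdist openE => y /= xy; rewrite /interior.
apply/metricType_numDomainType.nbhs_mdistP.
exists (w - mdist x y); first by rewrite /= subr_gt0.
by move=> z /= yz; rewrite (le_lt_trans (metric_triangle _ y _))// -ltrBrDl.
Qed.

(** [regular_measure] stops at twice the diameter, while the side radii may be larger. For [s > 0]
    the lower bound has to stop somewhere, the mass being at most 1; [B] will be a common bound for
    the distances and the side radii. *)
Definition ball_regular X (mu : probability (borelType X) R) (s c B : R) :=
  forall (x : X) (w : R), 0 < w ->
    (mu (ball x w) <= (c * w `^ s)%:E)%E /\
    (w <= B -> ((c^-1 * w `^ s)%:E <= mu (ball x w))%E).

Lemma ball_regularW X (mu : probability (borelType X) R) (s c c' B : R) :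
  0 < c -> c <= c' -> ball_regular mu s c B -> ball_regular mu s c' B.
Proof.
move=> c0 cc reg x w w0; have [up lo] := reg x w w0; split=> [|/lo].
  by apply: (le_trans up); rewrite lee_fin ler_wpM2r// powR_ge0.
apply: le_trans; rewrite lee_fin ler_wpM2r ?powR_ge0// lef_pV2 ?posrE//.
exact: lt_le_trans cc.
Qed.

(** A one-point space satisfies [regular_measure] vacuously for every [s >= 0]; the hypothesis on
    the diameter is what forces [s = 0] there. *)
Lemma regular_measure_bounded_radii X (mu : probability (borelType X) R)
    (s B D : R) :
  (forall x y : X, mdist x y <= D) -> regular_measure mu s ->
  (0 < s -> (0 < diam [set: X])%E) -> 0 < B ->
  exists c, 1 <= c /\ ball_regular mu s c B.
Proof.
move=> bX [s0 [c [c1 reg]]] nondeg B0.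
have mu1 (A : set X) : measurable (A : set (borelType X)) -> (mu A <= 1)%E.
  by move=> mA; exact: probability_le1.
have diam_ge (x y : X) : ((mdist x y)%:E <= diam [set: X])%E.
  by apply: ereal_sup_ubound; exists (x, y).
have diam_ge0 : (0 <= diam [set: X])%E.
  by apply: le_trans (diam_ge point point); rewrite lee_fin mdist_ge0.
have diam_fin : diam [set: X] \is a fin_num.
  rewrite ge0_fin_numE// (@le_lt_trans _ _ D%:E) ?ltry//.
  by apply: ge_ereal_sup => _ [[x y] _ <-]; rewrite lee_fin.
have c0 : 0 < c by exact: lt_le_trans c1.
set dl := fine (diam [set: X]); have dlE : diam [set: X] = dl%:E by rewrite fineK.
have dl_ge0 : 0 <= dl by rewrite -lee_fin -dlE.
have [dl0|dl_le0] := ltP 0 dl; last first.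
  have dl0 : dl = 0 by apply/eqP; rewrite eq_le dl_le0 dl_ge0.
  have s_eq0 : s = 0.
    apply/eqP; rewrite eq_le s0 andbT leNgt; apply/negP => /nondeg.
    by rewrite dlE dl0 ltxx.
  exists 1; split => // x w w0.
  have -> : ball x w = [set: X].
    apply/seteqP; split => // y _; rewrite ballEmdist/= (le_lt_trans _ w0)//.
    by rewrite -lee_fin (le_trans (diam_ge _ _))// dlE dl0.
  by rewrite probability_setT s_eq0 powRr0 invr1 mul1r.
have dd0 : 0 < dl *+ 2 by rewrite mulrn_wgt0.
have reg' (x : X) (w : R) : 0 < w -> w <= dl *+ 2 ->
    ((c^-1 * w `^ s)%:E <= mu (ball x w) <= (c * w `^ s)%:E)%E.
  by move=> w0 wd; apply: reg => //; rewrite dlE -EFinM lee_fin mulr_natl.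
(* For radii above [dl *+ 2]: [K1] turns the trivial bound 1 into a multiple of the [s]-th power of
   [w], and [K2] compares that power, for [w <= B], with the one of [dl *+ 2]. The final constant
   dominates [c], [K1] and [c * K2]. *)
set K1 := ((dl *+ 2) `^ s)^-1; set K2 := (B / (dl *+ 2)) `^ s.
have K10 : 0 <= K1 by rewrite invr_ge0 powR_ge0.
have K20 : 0 <= K2 by rewrite powR_ge0.
exists (c + K1 + c * K2); split.
  by rewrite -addrA (le_trans c1)// lerDl addr_ge0// mulr_ge0// ltW.
have cc' : c <= c + K1 + c * K2.
  by rewrite -addrA lerDl addr_ge0// mulr_ge0// ltW.
have cK0 : 0 <= c * K2 by rewrite mulr_ge0// ltW.
move=> x w w0; have [wle|wgt] := leP w (dl *+ 2).
  have /andP[lo up] := reg' x w w0 wle; split=> [|_].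
    by rewrite (le_trans up)// lee_fin ler_wpM2r// powR_ge0.
  rewrite (le_trans _ lo)// lee_fin ler_wpM2r ?powR_ge0//.
  by rewrite lef_pV2 ?posrE// (lt_le_trans c0).
split=> [|wB].
  apply: (le_trans (mu1 _ (measurable_ball x w))); rewrite lee_fin.
  apply: (@le_trans _ _ (K1 * w `^ s)).
    rewrite mulrC ler_pdivlMr ?powR_gt0// mul1r.
    by apply: ge0_ler_powR; rewrite ?nnegrE// ltW.
  by rewrite ler_wpM2r ?powR_ge0// -addrA addrCA lerDl addr_ge0// ltW.
have /andP[lo _] := reg' x (dl *+ 2) dd0 (lexx _).
apply: (@le_trans _ _ (mu (ball x (dl *+ 2)))); last first.
  apply: le_measure; rewrite ?inE; try exact: measurable_ball.
  exact/le_ball/ltW.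
apply: le_trans lo; rewrite lee_fin.
have K2p : 0 < K2 by rewrite powR_gt0// divr_gt0.
apply: (@le_trans _ _ ((c * K2)^-1 * w `^ s)).
  rewrite ler_wpM2r ?powR_ge0// lef_pV2 ?posrE; last 2 first.
  - exact: lt_le_trans cc'.
  - exact: mulr_gt0.
  by rewrite lerDr addr_ge0// ltW.
rewrite invfM -mulrA ler_wpM2l ?invr_ge0 ?(ltW c0)// mulrC ler_pdivrMr//.
rewrite -powRM ?divr_ge0 ?(ltW dd0) ?(ltW B0)// mulrC divfK ?gt_eqF//.
by apply: ge0_ler_powR; rewrite ?nnegrE// ltW// (lt_le_trans w0).
Qed.

End BallMeasure.

(** * Measure of boxes and the packing bound *)

Lemma measurable_box {R : realType} {d : nat} {dsp : 'I_d -> measure_display}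
    {T : forall i, measurableType (dsp i)} (A : forall i, set (T i)) :
  (forall i, measurable (A i)) ->
  measurable ([set x | forall i, A i (x i)] : set (product_space T)).
Proof.
move=> mA.
have -> : [set x : product_space T | forall i, A i (x i)] =
    \bigcap_(i in [set: 'I_d]) [set x | A i (x i)].
  by apply/seteqP; split => x h i *; exact: h.
apply: fin_bigcap_measurable; first exact: finite_finset.
move=> i _; apply: sub_sigma_algebra.
by exists i, (A i).
Qed.

Lemma product_measure_box {R : realType} {d : nat}
    {dsp : 'I_d -> measure_display} {T : forall i, measurableType (dsp i)}
    (m : forall i, probability (T i) R) (mu : probability (product_space T) R)
    (A : forall i, set (T i)) :
  is_product_measure m mu -> (forall i, measurable (A i)) ->
  mu [set x | forall i, A i (x i)] = (\prod_i fine (m i (A i)))%:E.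
Proof.
move=> muE mA.
have -> : [set x : product_space T | forall i, A i (x i)] =
    [set x | forall i, i \in [fset j | j in 'I_d]%fset -> A i (x i)].
  by apply/seteqP; split => x /= h i *; apply: h; rewrite in_fset.
rewrite muE//= -prodEFin big_imfset//= big_enum/=.
by apply: eq_bigr => i _; rewrite fineK// fin_num_measure.
Qed.

Lemma vol_scale {R : realType} {I : finType} (s w : I -> R) (a : R) :
  0 <= a -> (forall i, 0 <= w i) ->
  vol s (fun i => a * w i) = vol s (fun=> a) * vol s w.
Proof.
by move=> a0 w0; rewrite /vol -big_split/=; apply: eq_bigr => i _; rewrite powRM.
Qed.

Lemma vol_const {R : realType} {I : finType} (s : I -> R) (a : R) :
  0 < a -> vol s (fun=> a) = a `^ (\sum_i s i).
Proof. exact: prod_powR_const. Qed.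

Lemma vol_gt0 {R : realType} {I : finType} (s w : I -> R) :
  (forall i, 0 < w i) -> 0 < vol s w.
Proof. by move=> w0; apply: prodr_gt0 => i _; exact: powR_gt0. Qed.

Lemma le_vol {R : realType} {I : finType} (s v w : I -> R) :
  (forall i, 0 <= s i) -> (forall i, 0 < v i <= w i) -> vol s v <= vol s w.
Proof.
move=> s0 vw; apply: ler_prod => i _; rewrite powR_ge0/=.
have /andP[v0 vwi] := vw i.
by apply: ge0_ler_powR; rewrite ?nnegrE// ltW// (lt_le_trans v0).
Qed.

Lemma measurable_closed_ball {R : realType} (X : pointedMetricType R) (x : X)
    (w : R) :
  measurable ([set y | mdist x y <= w] : set (borelType X)).
Proof.
rewrite -[X in measurable X]setCK; apply: measurableC.
apply: sub_sigma_algebra; rewrite openE => y /= /negP; rewrite -ltNge => xy.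
rewrite /interior.
apply/metricType_numDomainType.nbhs_mdistP.
exists (mdist x y - w); first by rewrite /= subr_gt0.
move=> z /= yz; apply/negP; rewrite -ltNge.
have := metric_triangle x z y; rewrite (metric_sym z y); lra.
Qed.

Section Boxes.
Context {R : realType} {d : nat} {X : 'I_d -> pointedMetricType R}.
Context {s : 'I_d -> R} {mu_ : forall i, probability (borelType (X i)) R}.
Context {mu : probability (product_space (fun i => borelType (X i))) R}.
Context {c B : R}.
Hypothesis muE : is_product_measure mu_ mu.
Hypothesis c_ge1 : 1 <= c.
Hypothesis mu_reg : forall i, ball_regular (mu_ i) (s i) c B.
Local Notation T := (metric_prod X).
Implicit Types (x y z : T) (w : 'I_d -> R) (rho : R).

Definition box x w : set T := [set y | forall i, ball (x i) (w i) (y i)].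

Let c_gt0 : 0 < c. Proof. exact: lt_le_trans c_ge1. Qed.

Lemma measurable_box_ball x w :
  measurable (box x w : set (product_space (fun i => borelType (X i)))).
Proof.
apply: (@measurable_box R d _ (fun i => borelType (X i))
  (fun i => ball (x i) (w i))) => i.
exact: measurable_ball.
Qed.

Lemma measurable_closed_rectangle x w :
  measurable (closed_rectangle x w
    : set (product_space (fun i => borelType (X i)))).
Proof.
apply: (@measurable_box R d _ (fun i => borelType (X i))
  (fun i => [set y | mdist (x i) y <= w i])) => i.
exact: measurable_closed_ball.
Qed.

Lemma box_mass x w :
  mu (box x w) = (\prod_i fine (mu_ i (ball (x i) (w i))))%:E.
Proof.
apply: (@product_measure_box R d _ (fun i => borelType (X i)) mu_ mu
  (fun i => ball (x i) (w i)) muE) => i.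
exact: measurable_ball.
Qed.

Lemma box_le x w : (forall i, 0 < w i) ->
  (mu (box x w) <= (c ^+ d * vol s w)%:E)%E.
Proof.
move=> w0; have -> : c ^+ d = \prod_(i < d) c by rewrite prodr_const card_ord.
rewrite box_mass lee_fin -big_split/=.
apply: ler_prod => i _; rewrite fine_ge0//=.
have [up _] := mu_reg (x i) (w0 i).
by rewrite -lee_fin fineK// fin_num_measure//; exact: measurable_ball.
Qed.

Lemma box_ge x w : (forall i, 0 < w i <= B) ->
  (((c ^+ d)^-1 * vol s w)%:E <= mu (box x w))%E.
Proof.
move=> w0; have -> : (c ^+ d)^-1 = \prod_(i < d) c^-1.
  by rewrite prodr_const card_ord exprVn.
rewrite box_mass lee_fin -big_split/=.
apply: ler_prod => i _; rewrite mulr_ge0 ?powR_ge0 ?invr_ge0 ?(ltW c_gt0)//=.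
have /andP[wi0 wiB] := w0 i.
have [_ /(_ wiB) lo] := mu_reg (x i) wi0.
by rewrite -lee_fin fineK// fin_num_measure//; exact: measurable_ball.
Qed.

(** The boxes of radius [rho / 2] about the points of [Z] are disjoint and, as [rho <= w i], lie in
    the box with side radii [2 * w i]; compare masses. Each of the two mass bounds contributes one
    [c ^+ d], and 4 = 2 * 2 comes from halving [rho] and doubling [w]. *)
Lemma packing x w rho (Z : seq T) : 0 < rho <= B -> (forall i, rho <= w i) ->
  dist_separated rho Z -> (forall z, z \in Z -> closed_rectangle x w z) ->
  (size Z)%:R * rho `^ (\sum_i s i) <=
    (c ^+ d) ^+ 2 * 4 `^ (\sum_i s i) * vol s w.
Proof.
move=> /andP[rho0 rhoB] rw [uZ sZ] Zw.
set S := \sum_i s i; pose w2 i : R := 2 * w i.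
have w0 i : 0 < w i by exact: lt_le_trans (rw i).
have mbox z : measurable (box z (fun=> rho / 2)
  : set (product_space (fun i => borelType (X i)))) by exact: measurable_box_ball.
have cd0 : 0 < c ^+ d by rewrite exprn_gt0.
have finZ : finite_set [set` Z] by exact: finite_seq.
have : (mu (\bigcup_(z in [set` Z]) box z (fun=> (rho / 2)%R)) <=
    (c ^+ d * vol s w2)%:E)%E.
  apply: le_trans (box_le x (fun i => mulr_gt0 (ltr0Sn _ 1) (w0 i))).
  apply: le_measure; rewrite ?inE.
  - by apply: fin_bigcup_measurable.
  - exact: measurable_box_ball.
  move=> y [z /= zZ zy] i; have := zy i; rewrite !ballEmdist/= => zyi.
  rewrite (le_lt_trans (metric_triangle _ (z i) _))//.
  have := Zw _ zZ i; have := rw i; lra.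
rewrite measure_fin_bigcup//; last first.
  move=> a b /= aZ bZ [y [ay yb]]; apply: contrapT => /eqP ab.
  have := sZ _ _ aZ bZ ab; rewrite leNgt => /negP; apply.
  rewrite /mdist/=; apply/bigmax_ltP; split => // i _.
  rewrite (le_lt_trans (metric_triangle _ (y i) _))//.
  have := ay i; have := yb i; rewrite !ballEmdist/= => yb' ay'.
  by rewrite [X in _ + X]metric_sym; lra.
rewrite -fsbig_seq// => leZ.
have : (\sum_(z <- Z) ((c ^+ d)^-1 * vol s (fun=> rho / 2))%:E <=
    (c ^+ d * vol s w2)%:E)%E.
  apply: le_trans leZ; apply: lee_sum => z _; apply: box_ge => i.
  by rewrite divr_gt0//=; lra.
rewrite sumEFin lee_fin big_const_seq count_predT iter_addr_0 => le1.
have -> : rho `^ S = 2 `^ S * vol s (fun=> rho / 2).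
  by rewrite vol_const ?divr_gt0// -powRM ?divr_ge0 ?(ltW rho0)// mulrC divfK.
have -> : (4 : R) `^ S = 2 `^ S * 2 `^ S.
  by rewrite -powRM//; congr (_ `^ _); ring.
move: le1; have -> : vol s w2 = vol s (fun=> 2) * vol s w.
  by rewrite -vol_scale// => i; rewrite ltW.
rewrite (@vol_const _ _ s 2)// -/S => le1.
rewrite [leLHS](_ : _ = (c ^+ d * 2 `^ S) *
  ((size Z)%:R * ((c ^+ d)^-1 * vol s (fun=> rho / 2)))); last first.
  by field; rewrite gt_eqF.
rewrite [leRHS](_ : _ = (c ^+ d * 2 `^ S) *
  (c ^+ d * (2 `^ S * vol s w))); last by ring.
apply: ler_wpM2l; first by rewrite mulr_ge0 ?powR_ge0// ltW.
by rewrite mulr_natl.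
Qed.

End Boxes.

(** Flattens a doubly indexed cover into the single sequence of sets that [hausdorff_premeasure]
    asks for. *)
Lemma nneseries_pairing {R : realType} : exists2 f : nat -> nat * nat,
  (forall p, exists k, f k = p) &
  forall a : nat -> nat -> \bar R, (forall n m, 0 <= a n m)%E ->
    (\sum_(0 <= k <oo) a (f k).1 (f k).2 =
     \sum_(0 <= n <oo) \sum_(0 <= m <oo) a n m)%E.
Proof.
have /card_esym/ppcard_eqP[f] := card_nat2.
exists f => [p|a a0]; first by exists (f^-1%FUN p); rewrite invK ?inE.
rewrite nneseries_esum//.
rewrite [RHS]nneseries_esum; last by move=> n _; exact: nneseries_ge0.
under [RHS]eq_esum do rewrite nneseries_esum//.
rewrite esum_esum//.
rewrite (_ : [set x | xpredT x] = setT); last exact/seteqP.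
rewrite (_ : _ `*`` _ = setT); last exact/seteqP.
by rewrite (@reindex_esum _ _ _ setT setT f)//; split.
Qed.

(** * Null sets of the Hausdorff measure from countably many finite nets *)

Section HausdorffUpper.
Context {R : realType} {T : metricType R}.
Implicit Types (A U : set T) (t delta : R).

Lemma diam_ge0 A : A !=set0 -> (0 <= diam A)%E.
Proof.
move=> [x Ax]; apply: (@le_trans _ _ (mdist x x)%:E).
  by rewrite lee_fin mdist_ge0.
by apply: ereal_sup_ubound; exists (x, x).
Qed.

Lemma gauge_ge0 t A : (0 <= gauge t A)%E.
Proof. by rewrite /gauge; case: asboolP => // _; exact: poweR_ge0. Qed.

Lemma diam_set0 : diam (set0 : set T) = -oo%E.
Proof.
by apply/ereal_sup_ninfty => _ [[x y] [[]]].
Qed.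

Lemma gauge_set0 t : gauge t (set0 : set T) = 0%E.
Proof. by rewrite /gauge asboolT. Qed.

Lemma gauge_le t A (a : R) : 0 <= t -> 0 <= a -> (diam A <= a%:E)%E ->
  (gauge t A <= (a `^ t)%:E)%E.
Proof.
move=> t0 a0 Aa; rewrite /gauge; case: asboolP => [_|/eqP/set0P A0].
  by rewrite lee_fin powR_ge0.
rewrite -poweR_EFin gt0_ler_poweR// in_itv/= ?leey ?andbT.
  exact: diam_ge0.
by rewrite lee_fin.
Qed.

Lemma diam_closed_ball (x : T) (a : R) :
  (diam [set y | (mdist x y <= a)%R] <= (2 * a)%:E)%E.
Proof.
apply: ge_ereal_sup => _ [[y z] [/= xy xz] <-]; rewrite lee_fin.
rewrite (le_trans (metric_triangle _ x _))// metric_sym.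
by move: xy xz; lra.
Qed.

Lemma hausdorff_measure_eq0 t A : 0 <= t ->
  (forall eps delta : R, 0 < eps -> 0 < delta ->
    exists (Z : nat -> seq T) (rho : nat -> R),
      [/\ forall n, 0 < rho n, forall n, 2 * rho n <= delta,
        forall x, A x -> exists n, exists2 z, z \in Z n & mdist z x <= rho n &
        (\sum_(0 <= n <oo) ((size (Z n))%:R * (2 * rho n) `^ t)%:E <= eps%:E)%E]) ->
  hausdorff_measure t A = 0%E.
Proof.
move=> t0 cover.
have pre0 delta : 0 < delta -> hausdorff_premeasure t delta A = 0%E.
  move=> delta0; apply/eqP; rewrite eq_le; apply/andP; split; last first.
    apply: le_ereal_inf_tmp => _ [U _ <-].
    by apply: nneseries_ge0 => k _ _; exact: gauge_ge0.
  apply/lee_addgt0Pr => eps eps0; rewrite add0e.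
  have [Z [rho [rho0 rhod cov sumZ]]] := cover eps delta eps0 delta0.
  have [f fsurj fsum] := @nneseries_pairing R.
  (* Past the end of [Z n] the set is empty, and its gauge is 0 even for [t = 0], so only
     [size (Z n)] terms remain. The point [z0] is merely the default of [nth]. *)
  pose V n m := if (m < size (Z n))%N then
    if Z n is z0 :: _ then [set y | mdist (nth z0 (Z n) m) y <= rho n] else set0
    else set0.
  have dV n m : (diam (V n m) <= (2 * rho n)%:E)%E.
    rewrite /V; case: ifP => _; last by rewrite diam_set0 leNye.
    by case: (Z n) => [|z0 s]; rewrite ?diam_set0 ?leNye//; exact: diam_closed_ball.
  apply: (@le_trans _ _ (\sum_(0 <= k <oo) gauge t (V (f k).1 (f k).2))%E).
    apply: ereal_inf_lbound; exists (fun k => V (f k).1 (f k).2) => //; split.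
      by move=> k; apply: le_trans (dV _ _) _; rewrite lee_fin.
    move=> x /cov[n [z zZ zx]]; have [k fk] := fsurj (n, index z (Z n)).
    exists k => //; rewrite fk /V/= index_mem zZ.
    by case: (Z n) zZ => // z0 s zZ; rewrite /= nth_index.
  rewrite (fsum (fun n m => gauge t (V n m))); last first.
    by move=> n m; exact: gauge_ge0.
  apply: le_trans sumZ; apply: lee_nneseries => n *.
    by apply: nneseries_ge0 => k _ _; exact: gauge_ge0.
  rewrite (nneseries_split 0 (size (Z n)))//; last first.
    by move=> k _; exact: gauge_ge0.
  rewrite add0n [X in (_ + X)%E]eseries0 ?adde0; last first.
    by move=> k /= sk _; rewrite /V ltnNge sk/= gauge_set0.
  apply: (@le_trans _ _ (\sum_(0 <= m < size (Z n)) ((2 * rho n) `^ t)%:E)%E).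
    by apply: lee_sum => m _; apply: gauge_le => //; rewrite mulr_ge0// ltW.
  by rewrite sumEFin lee_fin big_const_nat subn0 iter_addr_0 [leRHS]mulr_natl.
apply/eqP; rewrite eq_le; apply/andP; split.
  by apply: ge_ereal_sup => _ [delta /= delta0 <-]; rewrite pre0.
by apply: ereal_sup_ubound; exists 1 => //=; rewrite pre0.
Qed.

End HausdorffUpper.

Lemma nneseries_tail_lt {R : realType} (f : nat -> R) (e : R) :
  (forall n, 0 <= f n) -> (\sum_(0 <= n <oo) (f n)%:E < +oo)%E -> 0 < e ->
  exists N, (\sum_(N <= n <oo) (f n)%:E < e%:E)%E.
Proof.
move=> f0 foo e0.
have /(_ _ (open_ereal_lt' _)) := nneseries_tail_cvg foo (fun k _ => f0 k).
move=> /(_ e%:E); rewrite lte_fin => /(_ e0) [N _ /(_ N (leqnn _))] fN.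
by exists N.
Qed.

(** * The upper bound, for every [omega] *)

Section UpperBound.
Context {R : realType} {d : nat} {X : 'I_d -> pointedMetricType R}.
Context {s : 'I_d -> R} {mu_ : forall i, probability (borelType (X i)) R}.
Context {mu : probability (product_space (fun i => borelType (X i))) R}.
Context {c B : R}.
Hypothesis muE : is_product_measure mu_ mu.
Hypothesis s_ge0 : forall i, 0 <= s i.
Hypothesis c_ge1 : 1 <= c.
Hypothesis mu_reg : forall i, ball_regular (mu_ i) (s i) c B.
Hypothesis B_gt0 : 0 < B.
Local Notation T := (metric_prod X).
Local Notation S := (\sum_i s i).

Definition packing_cst : R := (c ^+ d) ^+ 2 * 4 `^ S.

Lemma packing_cst_gt0 : 0 < packing_cst.
Proof. by rewrite mulr_gt0 ?powR_gt0 ?exprn_gt0// (lt_le_trans _ c_ge1). Qed.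

Lemma rectangle_net (A : set T) (x : T) (w : 'I_d -> R) (rho : R) :
  0 < rho <= B -> (forall i, rho <= w i) -> A `<=` closed_rectangle x w ->
  exists Z, [/\ dist_separated rho Z, forall z, z \in Z -> A z,
    forall y, A y -> exists2 z, z \in Z & mdist z y <= rho &
    (size Z)%:R * rho `^ S <= packing_cst * vol s w].
Proof.
move=> rhoB rw Aw; have /andP[rho0 _] := rhoB.
have pack Z : dist_separated rho Z -> (forall z, z \in Z -> A z) ->
    (size Z)%:R * rho `^ S <= packing_cst * vol s w.
  move=> sZ ZA; have ZR z : z \in Z -> closed_rectangle x w z by move=> /ZA /Aw.
  exact: (packing muE c_ge1 mu_reg rhoB rw sZ ZR).
pose N := Num.trunc (packing_cst * vol s w / rho `^ S).
have [Z sZ|Z [sZ ZA cov]] := @maximal_separated R T rho A N (ltW rho0).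
  move=> /(pack _ sZ); rewrite -ler_pdivlMr ?powR_gt0// => le1.
  by rewrite truncn_ge_nat// (le_trans _ le1).
by exists Z; split => //; exact: pack.
Qed.

Lemma limsup_hausdorff_measure0 (omega : nat -> T) (r : nat -> 'I_d -> R)
    (t : R) :
  (0 < d)%N -> (forall n i, 0 < r n i) -> 0 <= t <= S ->
  (\sum_(0 <= n <oo) (singular_value (r n) s t)%:E < +oo)%E ->
  hausdorff_measure t
    (lim_sup_set (fun n => closed_rectangle (omega n) (r n))) = 0%E.
Proof.
move=> d0 r0 tS sumoo; have /andP[t0 _] := tS.
pose Phi n := singular_value (r n) s t.
have Phi0 n : 0 < Phi n by apply: singular_value_gt0.
have K0 : 0 < packing_cst * 2 `^ t by rewrite mulr_gt0 ?packing_cst_gt0 ?powR_gt0.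
have KP n : 0 <= packing_cst * 2 `^ t * Phi n.
  by rewrite mulr_ge0 ?(ltW K0) ?(ltW (Phi0 n)).
apply: hausdorff_measure_eq0 => // eps delta eps0 delta0.
pose m := Num.min (delta / 2) B.
have m0 : 0 < m by rewrite lt_min B_gt0 divr_gt0.
(* The first bound makes the covering radii of the tail smaller than [m], the second makes the total
   cost of the tail at most [eps]. *)
pose e := Num.min (m `^ t) (eps / (packing_cst * 2 `^ t)).
have e0 : 0 < e by rewrite lt_min powR_gt0//= divr_gt0.
have [N tailN] := nneseries_tail_lt (fun n => ltW (Phi0 n)) sumoo e0.
have Phi_small n : (N <= n)%N -> Phi n < m `^ t.
  move=> Nn; suff : Phi n < e by rewrite lt_min => /andP[].
  rewrite -lte_fin; apply: le_lt_trans tailN.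
  rewrite (nneseries_split N (n - N)) ?subnKC//; last first.
    by move=> k _; rewrite lee_fin ltW.
  rewrite (nneseries_split n 1)//; last by move=> k _; rewrite lee_fin ltW.
  rewrite addn1 big_nat1 addeCA leeDl// adde_ge0//.
    by rewrite sumEFin lee_fin sumr_ge0// => k _; rewrite ltW.
  by apply: nneseries_ge0 => k _ _; rewrite lee_fin ltW.
have /choice[p pP] n : exists p : seq T * R, [/\ 0 < p.2, 2 * p.2 <= delta,
    (N <= n)%N -> forall y, closed_rectangle (omega n) (r n) y ->
      exists2 z, z \in p.1 & mdist z y <= p.2 &
    (size p.1)%:R * (2 * p.2) `^ t <=
      if (N <= n)%N then packing_cst * 2 `^ t * Phi n else 0].
  have [Nn|nN] := leqP N n; last first.
    (* A rectangle before the tail gets the empty net, with a dummy radius. *)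
    exists ([::], delta / 2); rewrite /= mul0r; split => //.
      by rewrite divr_gt0.
    by rewrite mulrC divfK.
  have [i PhiE] := singular_value_cost d0 (r0 n) s_ge0 tS.
  have rho0 : 0 < r n i by [].
  (* In the cost at radius [r n i] every maximum is at least [r n i]. Hence small singular values
     force small covering radii. *)
  have costE : r n i `^ t <= Phi n.
    rewrite /Phi PhiE /covering_cost.
    rewrite [in leLHS](_ : t = S + (t - S)); last by ring.
    rewrite [in leLHS]powRD ?(gt_eqF rho0) ?implybT// -(vol_const s)//.
    apply: ler_wpM2r; first exact: powR_ge0.
    by apply: le_vol => // j; rewrite r0 le_max lexx orbT.
  have rho_m : r n i < m.
    rewrite ltNge; apply/negP => mr; have := Phi_small _ Nn.
    rewrite ltNge => /negP; apply; apply: le_trans costE.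
    by apply: ge0_ler_powR; rewrite ?nnegrE// ltW.
  move: rho_m; rewrite lt_min => /andP[rd rB].
  have rhoB : 0 < r n i <= B by rewrite rho0 ltW.
  have [] := @rectangle_net (closed_rectangle (omega n) (r n)) (omega n)
    (fun j => Num.max (r n j) (r n i)) _ rhoB.
  - by move=> j; rewrite le_max lexx orbT.
  - by move=> y yr j; rewrite (le_trans (yr j))// le_max lexx.
  move=> Z [_ _ cov sizeZ]; exists (Z, r n i); split => //=.
    by move: rd; lra.
  rewrite powRM// ?(ltW rho0)// mulrCA [packing_cst * _]mulrC -mulrA.
  rewrite ler_wpM2l ?powR_ge0//.
  rewrite [in leLHS](_ : t = S + (t - S)); last by ring.
  rewrite [in leLHS]powRD ?(gt_eqF rho0) ?implybT// mulrA.
  rewrite /Phi PhiE /covering_cost mulrA.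
  by apply: ler_wpM2r => //; exact: powR_ge0.
exists (fun n => (p n).1), (fun n => (p n).2); split => [n|n|y|].
- by have [] := pP n.
- by have [] := pP n.
- move=> /(_ N I)[n /= Nn yn]; exists n.
  by have [_ _ /(_ Nn _ yn)] := pP n.
- apply: (@le_trans _ _ (\sum_(0 <= n <oo)
    (if (N <= n)%N then packing_cst * 2 `^ t * Phi n else 0)%:E)%E).
    apply: lee_nneseries => n *; first by rewrite lee_fin mulr_ge0 ?powR_ge0.
    by rewrite lee_fin; have [] := pP n.
  rewrite (nneseries_split 0 N); last first.
    by move=> k _; case: ifP => // _; rewrite lee_fin KP.
  rewrite add0n big_nat big1 ?add0e; last first.
    by move=> k /andP[_ kN]; rewrite leqNgt kN.
  apply: (@le_trans _ _ (\sum_(N <= n <oo)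
    ((packing_cst * 2 `^ t)%:E * (Phi n)%:E))%E).
    apply: lee_nneseries => n Nn *; last by case: ifP => // _; rewrite lee_fin KP.
    by case: ifP => // _; rewrite lee_fin KP.
  rewrite nneseriesZl; last by move=> n _; rewrite lee_fin ltW.
  rewrite muleC -lee_pdivlMr//; apply: le_trans (ltW tailN) _.
  by rewrite -EFinM lee_fin ge_min lexx orbT.
Qed.

(** A net of radius [rho] has at most a constant times [rho] to the power [- S] points, so its cost
    is of order [rho] to the power [t - S], which tends to 0 with [rho]. *)
Lemma hausdorff_measure0_above (D : R) (A : set T) (t : R) :
  (forall i (x y : X i), mdist x y <= D) -> (0 < d)%N -> S < t ->
  hausdorff_measure t A = 0%E.
Proof.
move=> bX d0 St.
have S0 : 0 <= S by exact: sumr_ge0.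
have t0 : 0 < t by exact: le_lt_trans St.
pose x0 : T := fun i => point.
have D0 : 0 <= D.
  by apply: le_trans (bX (Ordinal d0) point point); exact: mdist_ge0.
(* [W] is at least every distance and at least [rho], as [rectangle_net] requires. *)
pose W := D + B; have W0 : 0 < W by rewrite ltr_wpDl.
pose K := packing_cst * W `^ S * 2 `^ t.
have K0 : 0 < K by rewrite /K mulr_gt0 ?powR_gt0// mulr_gt0 ?packing_cst_gt0
  ?powR_gt0.
apply: hausdorff_measure_eq0 => [|eps delta eps0 delta0]; first exact: ltW.
pose rho := Num.min B (Num.min (delta / 2) ((eps / K) `^ (t - S)^-1)).
have rho0 : 0 < rho by rewrite !lt_min B_gt0 divr_gt0//= powR_gt0// divr_gt0.
have rhoB : 0 < rho <= B by rewrite rho0 ge_min lexx.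
have [] := @rectangle_net A x0 (fun=> W) rho rhoB.
- by move=> _; rewrite ge_min lerDr D0.
- by move=> y _ i; rewrite (le_trans (bX _ _ _))// lerDl ltW.
move=> Z [_ _ cov sizeZ].
exists (fun n => if n == 0%N then Z else [::]), (fun=> rho); split => [//|_|y Ay|].
- have : rho <= delta / 2 by rewrite !ge_min lexx orbT.
  by lra.
- by exists 0%N; exact: cov.
rewrite (nneseries_split 0 1); last first.
  by move=> k _; rewrite lee_fin mulr_ge0 ?powR_ge0.
rewrite big_nat1 eseries0 ?adde0; last first.
  by move=> [|k]//= _ _; rewrite mul0r.
rewrite lee_fin/= powRM ?(ltW rho0)//.
rewrite [in X in _ * (_ * X)](_ : t = S + (t - S)); last by ring.
rewrite [in leLHS]powRD ?(gt_eqF rho0) ?implybT//.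
apply: (@le_trans _ _ (K * rho `^ (t - S))).
  rewrite [leLHS](_ : _ = (size Z)%:R * rho `^ S * (2 `^ t * rho `^ (t - S)));
    last by ring.
  rewrite [leRHS](_ : _ = packing_cst * W `^ S * (2 `^ t * rho `^ (t - S)));
    last by rewrite /K; ring.
  apply: ler_wpM2r; first by rewrite mulr_ge0 ?powR_ge0.
  by move: sizeZ; rewrite (vol_const s).
rewrite mulrC -ler_pdivlMr//.
apply: (@le_trans _ _ (((eps / K) `^ (t - S)^-1) `^ (t - S))).
  apply: ge0_ler_powR; rewrite ?subr_ge0 ?nnegrE ?powR_ge0 ?(ltW rho0) ?(ltW St)//.
  by rewrite !ge_min lexx !orbT.
by rewrite -powRrM mulVf ?gt_eqF ?subr_gt0// powRr1// divr_ge0// ltW.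
Qed.

End UpperBound.

(** * Expectations of bounded measurable variables *)

Section Expectation.
Context {R : realType} {dsp : measure_display} {W : measurableType dsp}.
Variable P : probability W R.
Implicit Types (F G : W -> R) (A : set W) (a : R).

(** An algebra of integrable functions: sums and products of the random densities stay in it, so
    linearity of the expectation is always available. *)
Definition bounded_measurable F :=
  measurable_fun setT F /\ exists M, forall w, `|F w| <= M.

Definition expect F : R := \int[P]_(w in setT) F w.

Lemma eq_expect F G : (forall w, F w = G w) -> expect F = expect G.
Proof. by move=> FG; congr expect; exact/funext. Qed.

Lemma bounded_measurable_integrable F :
  bounded_measurable F -> P.-integrable setT (EFin \o F).
Proof.
move=> [mF [M FM]]; apply: measurable_bounded_integrable => //.
  by rewrite (le_lt_trans (probability_le1 P _)) ?ltry.
by exists M; split; [exact: num_real|move=> x xM y _ /=;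
  rewrite (le_trans (FM y)) ?ltW].
Qed.

Lemma bounded_measurable_indic A : measurable A -> bounded_measurable (\1_A).
Proof.
move=> mA; split; first exact: measurable_realfun.measurable_indic.
by exists 1 => w; rewrite indicE; case: (_ \in _); rewrite ?normr1 ?normr0.
Qed.

Lemma bounded_measurable_cst a : bounded_measurable (fun=> a).
Proof. by split; [exact: measurable_cst|exists `|a|]. Qed.

Lemma bounded_measurableD F G : bounded_measurable F -> bounded_measurable G ->
  bounded_measurable (fun w => F w + G w).
Proof.
move=> [mF [M FM]] [mG [N GN]]; split;
  first exact: measurable_realfun.measurable_funD.
by exists (M + N) => w; rewrite (le_trans (ler_normD _ _))// lerD.
Qed.

Lemma bounded_measurableM F G : bounded_measurable F -> bounded_measurable G ->
  bounded_measurable (fun w => F w * G w).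
Proof.
move=> [mF [M FM]] [mG [N GN]]; split;
  first exact: measurable_realfun.measurable_funM.
by exists (M * N) => w; rewrite normrM ler_pM.
Qed.

Lemma bounded_measurableZ a F : bounded_measurable F ->
  bounded_measurable (fun w => a * F w).
Proof. by apply: bounded_measurableM; exact: bounded_measurable_cst. Qed.

Lemma bounded_measurable_sum (I : Type) (l : seq I) (F : I -> W -> R) :
  (forall i, bounded_measurable (F i)) ->
  bounded_measurable (fun w => \sum_(i <- l) F i w).
Proof.
move=> mF; elim: l => [|i l IH].
  by under eq_fun do rewrite big_nil; exact: bounded_measurable_cst.
by under eq_fun do rewrite big_cons; exact: bounded_measurableD.
Qed.

Lemma expectD F G : bounded_measurable F -> bounded_measurable G ->
  expect (fun w => F w + G w) = expect F + expect G.
Proof. by move=> mF mG; rewrite /expect RintegralD//;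
  exact: bounded_measurable_integrable. Qed.

Lemma expectZ a F : bounded_measurable F ->
  expect (fun w => a * F w) = a * expect F.
Proof. by move=> mF; rewrite /expect RintegralZl//;
  exact: bounded_measurable_integrable. Qed.

Lemma expect_indic A : measurable A -> expect (\1_A) = fine (P A).
Proof. by move=> mA; rewrite /expect /Rintegral integral_indic// setIT. Qed.

Lemma expect_cst a : expect (fun=> a) = a.
Proof.
rewrite -[RHS]mulr1 -[X in _ = _ * X](_ : expect (\1_setT) = 1).
  rewrite -expectZ; last exact: bounded_measurable_indic.
  by congr expect; apply/funext => w; rewrite indicE in_setT mulr1.
by rewrite expect_indic// probability_setT.
Qed.

Lemma expect_sum (I : Type) (l : seq I) (F : I -> W -> R) :
  (forall i, bounded_measurable (F i)) ->
  expect (fun w => \sum_(i <- l) F i w) = \sum_(i <- l) expect (F i).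
Proof.
move=> mF; elim: l => [|i l IH].
  by under eq_fun do rewrite big_nil; rewrite big_nil expect_cst.
under eq_fun do rewrite big_cons; rewrite big_cons -IH expectD//.
exact: bounded_measurable_sum.
Qed.

Lemma le_expect F G : bounded_measurable F -> bounded_measurable G ->
  (forall w, F w <= G w) -> expect F <= expect G.
Proof.
move=> mF mG FG; rewrite /expect le_Rintegral//.
- exact: bounded_measurable_integrable.
- exact: bounded_measurable_integrable.
Qed.

Lemma expect_markov F a : bounded_measurable F -> (forall w, 0 <= F w) ->
  0 < a -> (P [set w | (a <= F w)%R] <= (expect F / a)%:E)%E.
Proof.
move=> mF F0 a0.
have mA : measurable [set w | a <= F w].
  rewrite -[X in measurable X]setTI.
  have -> : [set w | a <= F w] = F @^-1` `[a, +oo[.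
    by apply/seteqP; split => w /=; rewrite in_itv/= andbT.
  by apply: mF.1 => //; exact: measurable_itv.
rewrite -(fineK (fin_num_measure P _ mA)) lee_fin ler_pdivlMr// mulrC.
rewrite -expect_indic// -expectZ; last exact: bounded_measurable_indic.
apply: le_expect => //.
  by apply: bounded_measurableZ; exact: bounded_measurable_indic.
move=> w; rewrite indicE; case: (boolP (w \in _)) => [|_].
  by rewrite inE/= mulr1.
by rewrite mulr0.
Qed.

End Expectation.

(** * Independence over disjoint ranges of indices *)

Section Cylinders.
Context {R : realType} {dsp : measure_display} {V : measurableType dsp}.
Context {mu : probability V R}.
Local Notation Omega := (product_space (fun _ : nat => V)).
Context {P : probability Omega R}.
Hypothesis PE : is_product_measure (fun _ : nat => mu) P.
Implicit Types (F G : Omega -> R) (A : nat -> set V) (a b c : nat).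

Definition cylinder a b A : set Omega :=
  [set w | forall n, (a <= n < b)%N -> A n (w n)].

Lemma cylinderE a b A :
  cylinder a b A = [set w | forall n, n \in [fset i | i in index_iota a b]%fset
    -> A n (w n)].
Proof.
apply/seteqP; split => w /= h n nab; apply: h.
  by move: nab; rewrite in_fset/= mem_index_iota.
by rewrite in_fset/= mem_index_iota.
Qed.

Lemma measurable_cylinder a b A : (forall n, measurable (A n)) ->
  measurable (cylinder a b A).
Proof.
move=> mA.
have -> : cylinder a b A = \bigcap_(n in [set n | a <= n < b]%N) [set w | A n
  (w n)].
  by apply/seteqP; split => w h n /= nab; exact: h.
apply: bigcap_measurableType => n _; apply: sub_sigma_algebra.
by exists n, (A n).
Qed.

Lemma measure_cylinder a b A : (forall n, measurable (A n)) ->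
  fine (P (cylinder a b A)) = \prod_(a <= n < b) fine (mu (A n)).
Proof.
move=> mA; rewrite cylinderE PE// big_imfset//=.
under eq_bigr do rewrite -(fineK (fin_num_measure mu _ (mA _))).
rewrite prodEFin/=; apply: perm_big.
by rewrite uniq_perm ?undup_uniq ?iota_uniq// => n; rewrite mem_undup.
Qed.

(** The linear span of the indicators of cylinders over the indices from [a] to [b - 1]. The
    inductive form lets bilinear identities be proved on indicators only. *)
Inductive cylindrical a b : (Omega -> R) -> Prop :=
| cylindrical_indic A : (forall n, measurable (A n)) ->
    cylindrical a b (\1_(cylinder a b A))
| cylindricalD F G : cylindrical a b F -> cylindrical a b G ->
    cylindrical a b (fun w => F w + G w)
| cylindricalZ (k : R) F : cylindrical a b F -> cylindrical a b (fun w => k * F w).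

Lemma cylindrical_bounded_measurable a b F :
  cylindrical a b F -> bounded_measurable F.
Proof.
elim=> [A mA|? ? _ ? _ ?|k ? _ ?].
- by apply: bounded_measurable_indic; exact: measurable_cylinder.
- exact: bounded_measurableD.
- exact: bounded_measurableZ.
Qed.

Lemma cylinderI_indic a b A A' w :
  \1_(cylinder a b A) w * \1_(cylinder a b A') w =
  \1_(cylinder a b (fun n => A n `&` A' n)) w :> R.
Proof.
rewrite !indicE -natrM mulnb -in_setI; congr (_ %:R); congr (nat_of_bool (_ \in _)).
apply/seteqP; split => [v [h h'] n nab|v h]; first by split; [exact: h|exact: h'].
by split => n /h[].
Qed.

Lemma cylindricalM a b F G : cylindrical a b F -> cylindrical a b G ->
  cylindrical a b (fun w => F w * G w).
Proof.
move=> cF; elim=> {G} [A mA|G G' _ IH _ IH'|k G _ IH].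
- elim: cF => {F} [A' mA'|F F' _ IH _ IH'|k F _ IH].
  + under eq_fun do rewrite cylinderI_indic.
    by apply: cylindrical_indic => n; exact: measurableI.
  + by under eq_fun do rewrite mulrDl; exact: cylindricalD.
  + by under eq_fun do rewrite -mulrA; exact: cylindricalZ.
- by under eq_fun do rewrite mulrDr; exact: cylindricalD.
- by under eq_fun do rewrite mulrCA; exact: cylindricalZ.
Qed.

Lemma cylindrical_cst a b (k : R) : cylindrical a b (fun=> k).
Proof.
rewrite (_ : (fun=> k) = (fun w => k * \1_(cylinder a b (fun=> setT)) w)).
  by apply: cylindricalZ; exact: cylindrical_indic.
by apply/funext => w; rewrite indicE mem_set ?mulr1.
Qed.

Lemma cylindrical_sum a b (I : Type) (l : seq I) (F : I -> Omega -> R) :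
  (forall i, cylindrical a b (F i)) ->
  cylindrical a b (fun w => \sum_(i <- l) F i w).
Proof.
move=> mF; elim: l => [|i l IH].
  by under eq_fun do rewrite big_nil; exact: cylindrical_cst.
by under eq_fun do rewrite big_cons; exact: cylindricalD.
Qed.

Lemma cylindrical_coordinate a b n (A : set V) : (a <= n < b)%N ->
  measurable A -> cylindrical a b (fun w => \1_A (w n)).
Proof.
move=> nab mA; pose A' k := if k == n then A else setT.
rewrite (_ : (fun _ => _) = \1_(cylinder a b A')).
  by apply: cylindrical_indic => k; rewrite /A'; case: ifP.
apply/funext => w; rewrite !indicE; congr (_ %:R); congr nat_of_bool.
apply/idP/idP; rewrite !inE; [move=> Aw k kab|move=> /(_ n nab)]; rewrite /A'.
  by case: eqP => // ->.
by rewrite eqxx.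
Qed.

Lemma cylinder_cat a b c A A' w : (a <= b <= c)%N ->
  \1_(cylinder a b A) w * \1_(cylinder b c A') w =
  \1_(cylinder a c (fun n => if (n < b)%N then A n else A' n)) w :> R.
Proof.
move=> /andP[ab bc]; rewrite !indicE -natrM mulnb -in_setI; congr (_ %:R);
  congr (nat_of_bool (_ \in _)).
apply/seteqP; split => [v [h h'] n /andP[an nc]|v h].
  case: ifPn => [nb|]; first by apply: h; rewrite an.
  by rewrite -leqNgt => bn; apply: h'; rewrite bn.
split => n /andP[n1 n2].
  by have := h n; rewrite n1 (leq_trans n2 bc) n2; exact.
by have := h n; rewrite (leq_trans ab n1) n2 ltnNge n1; exact.
Qed.

Lemma cylindrical_cat a b c F G : (a <= b <= c)%N -> cylindrical a b F ->
  cylindrical b c G -> cylindrical a c (fun w => F w * G w).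
Proof.
move=> abc cF; elim=> {G} [A mA|G G' _ IH _ IH'|k G _ IH].
- elim: cF => {F} [A' mA'|F F' _ IH _ IH'|k F _ IH].
  + under eq_fun do rewrite cylinder_cat//.
    by apply: cylindrical_indic => n; case: ifP.
  + by under eq_fun do rewrite mulrDl; exact: cylindricalD.
  + by under eq_fun do rewrite -mulrA; exact: cylindricalZ.
- by under eq_fun do rewrite mulrDr; exact: cylindricalD.
- by under eq_fun do rewrite mulrCA; exact: cylindricalZ.
Qed.

(** By bilinearity two cylinder indicators suffice. Over adjacent ranges their product is again the
    indicator of a cylinder, whose probability is a product by [PE]. *)
Lemma expect_cylindrical_cat a b c F G : (a <= b <= c)%N ->
  cylindrical a b F -> cylindrical b c G ->
  expect P (fun w => F w * G w) = expect P F * expect P G.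
Proof.
move=> abc cF; have mF := cylindrical_bounded_measurable cF.
elim=> {G} [A mA|G G' cG IH cG' IH'|k G cG IH].
- elim: cF {mF} => {F} [A' mA'|F F' cF IH cF' IH'|k F cF IH].
  + under eq_expect do rewrite cylinder_cat//.
    have /andP[ab bc] := abc.
    rewrite !expect_indic; try exact: measurable_cylinder.
    * rewrite !measure_cylinder//; last by move=> n; case: ifP.
      rewrite (big_cat_nat ab bc)/=; congr (_ * _).
        by apply: eq_big_nat => n /andP[_ ->].
      by apply: eq_big_nat => n /andP[bn _]; rewrite ltnNge bn.
    * by apply: measurable_cylinder => n; case: ifP.
  + have mA' := bounded_measurable_indic (measurable_cylinder b c mA).
    have mF := cylindrical_bounded_measurable cF.
    have mF' := cylindrical_bounded_measurable cF'.
    under eq_expect do rewrite mulrDl.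
    rewrite expectD; try exact: bounded_measurableM.
    by rewrite expectD// mulrDl IH IH'.
  + have mA' := bounded_measurable_indic (measurable_cylinder b c mA).
    have mF := cylindrical_bounded_measurable cF.
    under eq_expect do rewrite -mulrA.
    rewrite expectZ; last exact: bounded_measurableM.
    by rewrite expectZ// IH mulrA.
- have mG := cylindrical_bounded_measurable cG.
  have mG' := cylindrical_bounded_measurable cG'.
  under eq_expect do rewrite mulrDr.
  rewrite expectD; try exact: bounded_measurableM.
  by rewrite expectD// mulrDr IH IH'.
- have mG := cylindrical_bounded_measurable cG.
  under eq_expect do rewrite mulrCA.
  rewrite expectZ; last exact: bounded_measurableM.
  by rewrite expectZ// IH mulrCA.
Qed.

Lemma expect_coordinate n (A : set V) : measurable A ->
  expect P (fun w => \1_A (w n)) = fine (mu A).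
Proof.
move=> mA; rewrite (_ : (fun _ => _) = \1_(cylinder n n.+1 (fun=> A))).
  rewrite expect_indic ?measure_cylinder//; last exact: measurable_cylinder.
  by rewrite big_nat1.
apply/funext => w; rewrite !indicE; congr (_ %:R); congr nat_of_bool.
apply/idP/idP; rewrite !inE; [move=> Aw k /andP[nk kn]|move=> /(_ n)].
  by have -> : k = n by apply/eqP; rewrite eqn_leq nk -ltnS kn.
by rewrite leqnn ltnSn; exact.
Qed.

Lemma expect_coordinate2 n m (A A' : set V) : measurable A -> measurable A' ->
  n != m ->
  expect P (fun w => \1_A (w n) * \1_A' (w m)) = fine (mu A) * fine (mu A').
Proof.
wlog nm : n m A A' / (n < m)%N => [hw|] mA mA'.
  rewrite neq_ltn => /orP[nm|mn]; first by apply: hw => //; rewrite ltn_eqF.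
  under eq_expect do rewrite mulrC; rewrite [RHS]mulrC; apply: hw => //.
  by rewrite ltn_eqF.
move=> _; rewrite (@expect_cylindrical_cat n n.+1 m.+1).
- by rewrite !expect_coordinate.
- by rewrite leqnSn ltnS ltnW.
- by apply: cylindrical_coordinate => //; rewrite leqnn ltnSn.
- by apply: cylindrical_coordinate => //; rewrite nm ltnSn.
Qed.

End Cylinders.

(** Telescoping: the last factor is expanded at each step and the earlier ones are bounded through
    [H]. The result is linear in [h], so a kernel can be summed against one [h j] at a time. *)
Lemma prod1D_le {R : realType} (h H : nat -> R) (J : nat) :
  (forall j, 0 <= h j <= H j) ->
  \prod_(j < J) (1 + h j) <=
    1 + \sum_(j < J) (\prod_(i < j) (1 + H i)) * h j.
Proof.
move=> hH; elim: J => [|J IH]; first by rewrite !big_ord0 addr0.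
rewrite !big_ord_recr/= mulrDr mulr1 addrA lerD//.
have /andP[h0 _] := hH J; rewrite ler_wpM2r//.
apply: ler_prod => i _; have /andP[hi0 hiH] := hH i.
by rewrite addr_ge0//= lerD2l.
Qed.


Lemma sum_half_le1 {R : realType} (J : nat) :
  \sum_(j < J) (2^-1 : R) ^+ j.+1 <= 1.
Proof.
suff -> : \sum_(j < J) (2^-1 : R) ^+ j.+1 = 1 - 2^-1 ^+ J.
  by rewrite gerBl exprn_ge0// invr_ge0.
elim: J => [|J IH]; first by rewrite big_ord0 expr0 subrr.
rewrite big_ord_recr/= IH exprS.
by set u := _ ^+ J; rewrite -[u in LHS]mul1r; lra.
Qed.

(** * Second moments of the random densities *)

Section RandomDensity.
Context {R : realType} {dsp : measure_display} {V : measurableType dsp}.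
Context {mu : probability V R}.
Local Notation Omega := (product_space (fun _ : nat => V)).
Context {P : probability Omega R}.
Hypothesis PE : is_product_measure (fun _ : nat => mu) P.
Context {T : Type}.
Variables (A : nat -> T -> set V) (a : nat -> nat -> R) (N : nat -> nat).
Implicit Types (x y : T) (w : Omega).

(** [A n x] stands for the set of centres for which the [n]-th rectangle contains [x]. *)
Definition hit_prob n x : R := fine (mu (A n x)).

Definition density_factor j x w : R :=
  \sum_(N j <= n < N j.+1) a j n / hit_prob n x * \1_(A n x) (w n).

Definition density J x w : R := \prod_(j < J) density_factor j x w.

(** The diagonal terms [n = m] in the expected product of the factors at [x] and [y]: the h_j of the
    overview. *)
Definition correlation j x y : R :=
  \sum_(N j <= n < N j.+1)
    a j n ^+ 2 * (fine (mu (A n x `&` A n y)) / (hit_prob n x * hit_prob n y)).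

Hypothesis mA : forall n x, measurable (A n x).
Hypothesis hit_gt0 : forall n x, 0 < hit_prob n x.
Hypothesis a_ge0 : forall j n, 0 <= a j n.
Hypothesis N_mono : forall j, (N j <= N j.+1)%N.
Hypothesis sum_a : forall j, \sum_(N j <= n < N j.+1) a j n = 1.

Let N0J J : (N 0 <= N J)%N.
Proof. by elim: J => // J IH; exact: leq_trans (N_mono J). Qed.

Lemma density_factor_ge0 j x w : 0 <= density_factor j x w.
Proof.
apply: sumr_ge0 => n _; rewrite mulr_ge0 ?divr_ge0 ?(ltW (hit_gt0 _ _))//.
Qed.

Lemma density_ge0 J x w : 0 <= density J x w.
Proof. by apply: prodr_ge0 => j _; exact: density_factor_ge0. Qed.

(** This locates the random mass: it sits on points hit by every block before [J]. *)
Lemma density_neq0 J x w j : density J x w != 0 -> (j < J)%N ->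
  exists2 n, (N j <= n < N j.+1)%N & A n x (w n).
Proof.
move=> f0 jJ; apply: contrapT => none; move/eqP : f0; apply.
rewrite /density (bigD1 (Ordinal jJ))//= {1}/density_factor big_nat big1 ?mul0r//.
move=> n nj; rewrite indicE; case: (boolP (w n \in A n x)) => [|_].
  by rewrite inE => An; exfalso; apply: none; exists n.
by rewrite mulr0.
Qed.

Lemma density_factor_cylindrical j x :
  cylindrical (N j) (N j.+1) (density_factor j x).
Proof.
rewrite /density_factor (_ : (fun _ => _) = (fun w => \sum_(i < N j.+1 - N j)
    a j (i + N j)%N / hit_prob (i + N j)%N x * \1_(A (i + N j)%N x) (w (i + N
      j)%N))).
  apply: cylindrical_sum => i; apply: cylindricalZ.
  by apply: cylindrical_coordinate => //; have := ltn_ord i; lia.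
by apply/funext => w; rewrite -{1}(add0n (N j)) big_addn big_mkord.
Qed.

Lemma density_cylindrical J x : cylindrical (N 0) (N J) (density J x).
Proof.
elim: J => [|J IH].
  rewrite /density; under eq_fun do rewrite big_ord0.
  exact: cylindrical_cst.
rewrite /density; under eq_fun do rewrite big_ord_recr/=.
apply: cylindrical_cat IH (density_factor_cylindrical J x).
by rewrite N0J N_mono.
Qed.

Lemma expect_density_factor j x : expect P (density_factor j x) = 1.
Proof.
rewrite expect_sum => [|n]; last first.
  apply: bounded_measurableZ.
  by apply: (@cylindrical_bounded_measurable _ _ _ n n.+1);
    apply: cylindrical_coordinate; rewrite ?leqnn ?ltnSn.
rewrite -[RHS](sum_a j); apply: eq_bigr => n _.
rewrite expectZ; last first.
  by apply: (@cylindrical_bounded_measurable _ _ _ n n.+1);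
    apply: cylindrical_coordinate; rewrite ?leqnn ?ltnSn.
by rewrite (expect_coordinate PE)// divfK// gt_eqF.
Qed.

Lemma expect_density J x : expect P (density J x) = 1.
Proof.
elim: J => [|J IH]; rewrite /density.
  by under eq_expect do rewrite big_ord0; rewrite expect_cst.
under eq_expect do rewrite big_ord_recr/=.
rewrite (expect_cylindrical_cat PE _ (density_cylindrical J x)
  (density_factor_cylindrical J x)); last by rewrite N0J N_mono.
by rewrite IH expect_density_factor mulr1.
Qed.

Lemma correlation_ge0 j x y : 0 <= correlation j x y.
Proof.
apply: sumr_ge0 => n _; rewrite mulr_ge0 ?sqr_ge0// divr_ge0 ?fine_ge0//.
by rewrite mulr_ge0 ?(ltW (hit_gt0 _ _)).
Qed.

(** Off the diagonal, independence cancels both hit probabilities and leaves [a j n * a j m]. Adding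
    these products on the diagonal as well completes the square of the sum of the weights, which is
    1. *)
Lemma expect_density_factorM j x y :
  expect P (fun w => density_factor j x w * density_factor j y w) <=
    1 + correlation j x y.
Proof.
have bm n z : bounded_measurable (fun w : Omega => \1_(A n z) (w n) : R).
  by apply: (@cylindrical_bounded_measurable _ _ _ n n.+1);
    apply: cylindrical_coordinate; rewrite ?leqnn ?ltnSn.
pose p n z := a j n / hit_prob n z.
under eq_expect do rewrite mulr_suml.
rewrite expect_sum => [|n]; last first.
  apply: bounded_measurableM; first exact: bounded_measurableZ.
  by apply: bounded_measurable_sum => m; exact: bounded_measurableZ.
apply: (@le_trans _ _ (\sum_(N j <= n < N j.+1) \sum_(N j <= m < N j.+1)
    (a j n * a j m + (n == m)%:R * (a j n ^+ 2 *
       (fine (mu (A n x `&` A n y)) / (hit_prob n x * hit_prob n y))))));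
         last first.
  under eq_bigr do rewrite big_split/= -mulr_sumr sum_a mulr1.
  rewrite big_split/= sum_a lerD2l.
  rewrite [leLHS]big_nat [leRHS]big_nat; apply: ler_sum => n nj.
  rewrite -mulr_suml (_ : \sum_(_ <= _ < _) _ = 1) ?mul1r//.
  rewrite (bigD1_seq n)/= ?mem_index_iota ?iota_uniq// eqxx big1 ?addr0// => m.
  by rewrite eq_sym => /negbTE ->.
apply: ler_sum => n _.
under eq_expect do rewrite mulr_sumr.
rewrite expect_sum => [|m]; last first.
  by apply: bounded_measurableM; exact: bounded_measurableZ.
apply: ler_sum => m _; under eq_expect do rewrite mulrACA.
rewrite expectZ; last exact: bounded_measurableM.
have [<-|nm] := eqVneq n m; last first.
  rewrite (expect_coordinate2 PE)// mul0r addr0 mulrACA.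
  by rewrite !divfK// gt_eqF.
rewrite mul1r (@eq_expect _ _ _ P _ (fun w => \1_(A n x `&` A n y) (w n)));
  last first.
  by move=> w; rewrite indicI.
rewrite (expect_coordinate PE); last exact: measurableI.
rewrite (_ : _ * _ = a j n ^+ 2 *
    (fine (mu (A n x `&` A n y)) / (hit_prob n x * hit_prob n y))).
  by rewrite lerDr mulr_ge0.
by rewrite invfM expr2; ring.
Qed.

Lemma expect_densityM J x y :
  expect P (fun w => density J x w * density J y w) <=
    \prod_(j < J) (1 + correlation j x y).
Proof.
elim: J => [|J IH]; rewrite /density.
  by under eq_expect do rewrite !big_ord0 mulr1; rewrite expect_cst big_ord0.
under eq_expect do rewrite !big_ord_recr/= mulrACA.
rewrite (expect_cylindrical_cat PE _
  (cylindricalM (density_cylindrical J x) (density_cylindrical J y))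
  (cylindricalM (density_factor_cylindrical J x) (density_factor_cylindrical J y)));
  last by rewrite N0J N_mono.
have ge0E (F : Omega -> R) : bounded_measurable F -> (forall w, 0 <= F w) ->
    0 <= expect P F.
  move=> mF F0; rewrite -[leLHS](expect_cst P); apply: le_expect => //.
  exact: bounded_measurable_cst.
rewrite big_ord_recr/= ler_pM//.
- apply: ge0E => [|w]; last by rewrite mulr_ge0 ?density_ge0.
  by apply: bounded_measurableM; apply: cylindrical_bounded_measurable;
    exact: density_cylindrical.
- apply: ge0E => [|w]; last by rewrite mulr_ge0 ?density_factor_ge0.
  by apply: bounded_measurableM; apply: cylindrical_bounded_measurable;
    exact: density_factor_cylindrical.
exact: expect_density_factorM.
Qed.


Lemma density_bounded_measurable J x : bounded_measurable (density J x).
Proof. by apply: cylindrical_bounded_measurable; exact: density_cylindrical. Qed.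

Definition mass (Z : seq T) (q : R) J w : R := \sum_(x <- Z) q * density J x w.

Definition energy (Z : seq T) (q : R) (kappa : T -> T -> R) J w : R :=
  \sum_(x <- Z) \sum_(y <- Z)
    q ^+ 2 * kappa x y * (density J x w * density J y w).

(** One variable of small expectation expresses both demands, mass close to 1 and bounded energy, so
    that Markov's inequality is applied only once. *)
Definition deviation (Z : seq T) (q : R) (kappa : T -> T -> R) (eta : R) J w : R :=
  (mass Z q J w - 1) ^+ 2 + eta * energy Z q kappa J w.

Section Deviation.
Variables (Z : seq T) (q : R) (kappa : T -> T -> R) (eta K : R) (J : nat).
Variable H : nat -> R.
Hypothesis q_size : q * (size Z)%:R = 1.
Hypothesis eta01 : 0 < eta <= 1.
Hypothesis kappa_ge1 : forall x y, 1 <= kappa x y.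
Hypothesis kappa_sum : \sum_(x <- Z) \sum_(y <- Z) q ^+ 2 * kappa x y <= K.
Hypothesis corr_le : forall j x y, correlation j x y <= H j.
Hypothesis corr_sum : forall j, (j < J)%N ->
  (\prod_(i < j) (1 + H i)) *
    \sum_(x <- Z) \sum_(y <- Z) q ^+ 2 * kappa x y * correlation j x y <=
  eta * 2^-1 ^+ j.+1.

Lemma deviationE w : deviation Z q kappa eta J w =
  \sum_(x <- Z) \sum_(y <- Z)
    q ^+ 2 * (1 + eta * kappa x y) * (density J x w * density J y w)
  + (-2 * mass Z q J w + 1).
Proof.
rewrite /deviation [LHS](_ : _ = (mass Z q J w * mass Z q J w
  + eta * energy Z q kappa J w) + (-2 * mass Z q J w + 1)); last by ring.
congr (_ + _).
have -> : mass Z q J w * mass Z q J w = \sum_(x <- Z) \sum_(y <- Z)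
    q ^+ 2 * (density J x w * density J y w).
  rewrite [LHS]mulr_suml; apply: eq_bigr => x _.
  by rewrite mulr_sumr; apply: eq_bigr => y _; ring.
rewrite /energy mulr_sumr -big_split/=; apply: eq_bigr => x _.
by rewrite mulr_sumr -big_split/=; apply: eq_bigr => y _; ring.
Qed.

Lemma mass_bounded_measurable : bounded_measurable (mass Z q J).
Proof.
apply: bounded_measurable_sum => x; apply: bounded_measurableZ.
exact: density_bounded_measurable.
Qed.

Let bm_term (k : T -> T -> R) x : bounded_measurable (fun w =>
  \sum_(y <- Z) k x y * (density J x w * density J y w)).
Proof.
apply: bounded_measurable_sum => y; apply: bounded_measurableZ.
by apply: bounded_measurableM; exact: density_bounded_measurable.
Qed.

Lemma deviation_bounded_measurable :
  bounded_measurable (deviation Z q kappa eta J).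
Proof.
rewrite (_ : deviation _ _ _ _ _ = (fun w => \sum_(x <- Z) \sum_(y <- Z)
    q ^+ 2 * (1 + eta * kappa x y) * (density J x w * density J y w)
  + (-2 * mass Z q J w + 1))); last by apply/funext => w; exact: deviationE.
apply: bounded_measurableD.
  by apply: bounded_measurable_sum => x;
    exact: (bm_term (fun x y => q ^+ 2 * (1 + eta * kappa x y))).
apply: bounded_measurableD; last exact: bounded_measurable_cst.
by apply: bounded_measurableZ; exact: mass_bounded_measurable.
Qed.

Let kappa_ge0 x y : 0 <= kappa x y. Proof. exact: le_trans (kappa_ge1 x y). Qed.

Lemma energy_ge0 w : 0 <= energy Z q kappa J w.
Proof.
apply: sumr_ge0 => x _; apply: sumr_ge0 => y _.
by apply: mulr_ge0; apply: mulr_ge0; rewrite ?sqr_ge0 ?density_ge0 ?kappa_ge0.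
Qed.

Lemma deviation_ge0 w : 0 <= deviation Z q kappa eta J w.
Proof.
have /andP[e0 _] := eta01.
by rewrite addr_ge0 ?sqr_ge0// mulr_ge0 ?energy_ge0 ?(ltW e0).
Qed.

Lemma expect_mass : expect P (mass Z q J) = 1.
Proof.
have bmd := density_bounded_measurable J.
rewrite expect_sum => [|x]; last exact: bounded_measurableZ.
rewrite (eq_bigr (fun=> q)) => [|x _]; last first.
  by rewrite expectZ// expect_density mulr1.
by rewrite big_const_seq count_predT iter_addr_0 -mulr_natr.
Qed.

(** Each expected product in [deviationE] is bounded by [expect_densityM] and [prod1D_le]. The terms
    [q ^+ 2] sum to 1 and cancel against [-2 + 1]; the kernel terms give [eta * K]; the correlation
    terms, where [1 + eta * kappa x y <= 2 * kappa x y], give at most [2 * eta] by [corr_sum] and a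
    geometric series. *)
Lemma expect_deviation_le : expect P (deviation Z q kappa eta J) <= eta * (K + 2).
Proof.
have /andP[e0 e1] := eta01.
have [n0 n1] : 0 <= eta /\ eta <= 1 by rewrite ltW.
rewrite (eq_expect _ deviationE) expectD; last 2 first.
- by apply: bounded_measurable_sum => x;
  exact: (bm_term (fun x y => q ^+ 2 * (1 + eta * kappa x y))).
- apply: bounded_measurableD; last exact: bounded_measurable_cst.
  by apply: bounded_measurableZ; exact: mass_bounded_measurable.
rewrite expectD; last 2 first.
- by apply: bounded_measurableZ; exact: mass_bounded_measurable.
- exact: bounded_measurable_cst.
rewrite expectZ; last exact: mass_bounded_measurable.
rewrite expect_mass expect_cst expect_sum; last by move=> x;
  exact: (bm_term (fun x y => q ^+ 2 * (1 + eta * kappa x y))).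
pose C j := \prod_(i < j) (1 + H i).
have H0 j x y : 0 <= H j by exact: le_trans (correlation_ge0 _ _ _) (corr_le j x y).
apply: (@le_trans _ _ (\sum_(x <- Z) \sum_(y <- Z) (q ^+ 2 +
    (eta * (q ^+ 2 * kappa x y) +
     2 * \sum_(j < J) C j * (q ^+ 2 * kappa x y * correlation j x y))) +
    (-2 * 1 + 1))).
  rewrite lerD2r; apply: ler_sum => x _; rewrite expect_sum; last first.
    move=> y; apply: bounded_measurableZ.
    by apply: bounded_measurableM; exact: density_bounded_measurable.
  apply: ler_sum => y _; rewrite expectZ; last first.
    by apply: bounded_measurableM; exact: density_bounded_measurable.
  have k1 := kappa_ge1 x y; have q0 : 0 <= q ^+ 2 by exact: sqr_ge0.
  set k := q ^+ 2 * (1 + _).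
  have kk0 := kappa_ge0 x y.
  have k0 : 0 <= k by rewrite /k mulr_ge0// addr_ge0// mulr_ge0.
  apply: (@le_trans _ _ (k * (1 + \sum_(j < J) C j * correlation j x y))).
    apply: ler_wpM2l => //; apply: le_trans (expect_densityM _ _ _) _.
    apply: (@prod1D_le _ (fun j => correlation j x y) H) => j.
    by rewrite correlation_ge0 corr_le.
  rewrite mulrDr mulr1 [leRHS]addrA lerD//.
    by rewrite le_eqVlt; apply/orP; left; apply/eqP; rewrite /k; ring.
  apply: (@le_trans _ _ ((2 * (q ^+ 2 * kappa x y)) *
      \sum_(j < J) C j * correlation j x y)).
    apply: ler_wpM2r.
      apply: sumr_ge0 => j _; rewrite mulr_ge0 ?correlation_ge0//.
      by apply: prodr_ge0 => i _; rewrite addr_ge0// (H0 i x y).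
    rewrite /k mulrCA ler_wpM2l// mulr_natl mulr2n lerD//.
    by rewrite ler_piMl.
  rewrite -mulrA ler_wpM2l// mulr_sumr; apply: ler_sum => j _.
  by rewrite mulrCA.
rewrite (_ : \sum_(x <- Z) _ = \sum_(x <- Z) \sum_(y <- Z) q ^+ 2 +
    (eta * \sum_(x <- Z) \sum_(y <- Z) q ^+ 2 * kappa x y +
     2 * \sum_(x <- Z) \sum_(y <- Z) \sum_(j < J)
       C j * (q ^+ 2 * kappa x y * correlation j x y))); last first.
  rewrite !mulr_sumr -!big_split/=; apply: eq_bigr => x _.
  by rewrite !mulr_sumr -!big_split.
have -> : \sum_(x <- Z) \sum_(y <- Z) q ^+ 2 = 1.
  have cst (z : R) : \sum_(x <- Z) z = z * (size Z)%:R.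
    by rewrite big_const_seq count_predT iter_addr_0 mulr_natr.
  by under eq_bigr do rewrite cst; rewrite cst -mulrA -expr2 -exprMn q_size expr1n.
have -> : \sum_(x <- Z) \sum_(y <- Z) \sum_(j < J)
    C j * (q ^+ 2 * kappa x y * correlation j x y) =
    \sum_(j < J) C j * \sum_(x <- Z) \sum_(y <- Z)
      q ^+ 2 * kappa x y * correlation j x y.
  under eq_bigr do rewrite exchange_big/=.
  rewrite exchange_big/=; apply: eq_bigr => j _; rewrite mulr_sumr.
  by apply: eq_bigr => x _; rewrite mulr_sumr.
have le1 : \sum_(j < J) C j * \sum_(x <- Z) \sum_(y <- Z)
      q ^+ 2 * kappa x y * correlation j x y <= eta.
  apply: (@le_trans _ _ (\sum_(j < J) eta * 2^-1 ^+ j.+1)).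
    by apply: ler_sum => j _; exact: corr_sum.
  by rewrite -mulr_sumr ler_piMr// sum_half_le1.
have le2 : eta * (\sum_(x <- Z) \sum_(y <- Z) q ^+ 2 * kappa x y) <= eta * K.
  by rewrite ler_wpM2l.
by move: le1 le2; rewrite mulrDr; lra.
Qed.

Lemma deviation_prob : (P [set w | (4^-1 <= deviation Z q kappa eta J w)%R] <=
  (4 * (eta * (K + 2)))%:E)%E.
Proof.
apply: le_trans (expect_markov P deviation_bounded_measurable deviation_ge0 _) _.
  by rewrite invr_gt0.
by rewrite invrK lee_fin mulrC ler_wpM2l// expect_deviation_le.
Qed.

(** The threshold 1/4 is the square of 1/2, so the mass stays within 1/2 of 1. *)
Lemma deviation_lt w : deviation Z q kappa eta J w < 4^-1 ->
  2^-1 <= mass Z q J w /\ energy Z q kappa J w <= (4 * eta)^-1.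
Proof.
have /andP[e0 e1] := eta01 => dev.
have E0 := energy_ge0 w.
have m2 : (mass Z q J w - 1) ^+ 2 < 4^-1.
  by apply: le_lt_trans dev; rewrite lerDl mulr_ge0 ?(ltW e0).
split.
  rewrite leNgt; apply/negP => m1; move: m2; rewrite ltNge => /negP; apply.
  by move: m1; set m := mass _ _ _ _ => m1; nra.
rewrite invfM ler_pdivlMr// mulrC; apply: le_trans (ltW dev).
by rewrite lerDr sqr_ge0.
Qed.

End Deviation.

End RandomDensity.

Lemma exprn_powR {R : realType} (x t : R) (k : nat) : 0 <= x ->
  (x ^+ k) `^ t = (x `^ t) ^+ k.
Proof.
move=> x0; elim: k => [|k IH]; first by rewrite !expr0 powR1.
by rewrite !exprS powRM ?exprn_ge0// IH.
Qed.

Lemma sum_geometric_le {R : realType} (u : R) (K : nat) : 0 <= u < 1 ->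
  \sum_(k < K) u ^+ k <= (1 - u)^-1.
Proof.
move=> /andP[u0 u1]; have v0 : 0 < 1 - u by rewrite subr_gt0.
rewrite -[leRHS]mul1r ler_pdivlMr//.
suff -> : (\sum_(k < K) u ^+ k) * (1 - u) = 1 - u ^+ K.
  by rewrite gerBl exprn_ge0.
elim: K => [|K IH]; first by rewrite big_ord0 mul0r expr0 subrr.
by rewrite big_ord_recr/= mulrDl IH exprS; ring.
Qed.

(** * The dyadic energy kernel *)

Section Kernel.
Context {R : realType} {T : metricType R}.
Implicit Types (D t : R) (x y : T).

Definition dyadic D (k : nat) : R := D * 2^-1 ^+ k.

(** For [t > 0] and distances up to [D], comparable to the Riesz kernel, the [t]-th power of
    [D / mdist x y], cut off at the scale [dyadic D K]. As a sum of indicators it only calls for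
    counting points in balls. *)
Definition dyadic_kernel D t K x y : R :=
  \sum_(k < K.+1) (2 `^ t) ^+ k * (mdist x y <= dyadic D k)%R%:R.

Lemma dyadic_gt0 D k : 0 < D -> 0 < dyadic D k.
Proof. by move=> D0; rewrite mulr_gt0// exprn_gt0// invr_gt0. Qed.

Lemma dyadicS D k : dyadic D k.+1 = dyadic D k / 2.
Proof. by rewrite /dyadic exprSr mulrA. Qed.

Lemma le_dyadic D k l : 0 < D -> (k <= l)%N -> dyadic D l <= dyadic D k.
Proof.
move=> D0 kl; rewrite /dyadic ler_wpM2l ?(ltW D0)//.
by rewrite ler_wiXn2l// ?invr_ge0// invf_le1// ler1n.
Qed.

Lemma kernel_ge0 D t K x y : 0 <= dyadic_kernel D t K x y.
Proof. by apply: sumr_ge0 => k _; rewrite mulr_ge0 ?exprn_ge0 ?powR_ge0. Qed.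

Lemma kernel_ge D t K x y k : (k <= K)%N -> mdist x y <= dyadic D k ->
  (2 `^ t) ^+ k <= dyadic_kernel D t K x y.
Proof.
move=> kK xy; have kK' : (k < K.+1)%N by rewrite ltnS.
rewrite /dyadic_kernel (bigD1 (Ordinal kK'))//= xy mulr1 lerDl.
by apply: sumr_ge0 => i _; rewrite mulr_ge0 ?exprn_ge0 ?powR_ge0.
Qed.

Lemma kernel_ge1 D t K x y : mdist x y <= D -> 1 <= dyadic_kernel D t K x y.
Proof.
by move=> xyD; have := @kernel_ge D t K x y 0 (leq0n _);
  rewrite expr0 /dyadic expr0 mulr1; exact.
Qed.

End Kernel.

(** * Kernel sums over a rectangle *)

Section KernelSum.
Context {R : realType} {d : nat} {X : 'I_d -> pointedMetricType R}.
Context {s : 'I_d -> R} {mu_ : forall i, probability (borelType (X i)) R}.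
Context {mu : probability (product_space (fun i => borelType (X i))) R}.
Context {c D : R}.
Hypothesis muE : is_product_measure mu_ mu.
Hypothesis s_ge0 : forall i, 0 <= s i.
Hypothesis c_ge1 : 1 <= c.
Hypothesis D_gt0 : 0 < D.
Hypothesis mu_reg : forall i, ball_regular (mu_ i) (s i) c D.
Local Notation T := (metric_prod X).
Local Notation S := (\sum_i s i).
Variables (t t' : R).
Hypothesis tt' : t' < t.

(** Open boxes of the doubled radius about the net cover the space; doubling absorbs the passage
    from closed to open balls. *)
Lemma net_size_ge (rho : R) (Z : seq T) : 0 < rho ->
  (forall y : T, exists2 z, z \in Z & mdist z y <= rho) ->
  1 <= (size Z)%:R * (c ^+ d * (2 * rho) `^ S).
Proof.
move=> rho0 cov; have rho2 : 0 < 2 * rho by rewrite mulr_gt0.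
have mbox z : measurable (box z (fun=> (2 * rho)%R)
  : set (product_space (fun i => borelType (X i)))) by exact: measurable_box_ball.
rewrite -lee_fin -(probability_setT mu).
apply: (@le_trans _ _ (mu (\big[setU/set0]_(z <- Z) box z (fun=> (2 * rho)%R)))).
  apply: le_measure; rewrite ?inE//; first exact: bigsetU_measurable.
  move=> y _; have [z zZ zy] := cov y; rewrite -bigcup_seq; exists z => //= i.
  rewrite ballEmdist/=; apply: (@le_lt_trans _ _ rho); last by lra.
  by have /(mdist_closed_rectangle _ _ (ltW rho0))/(_ i) := zy.
apply: (@le_trans _ _ (\sum_(z <- Z) mu (box z (fun=> (2 * rho)%R)))%E).
  elim: {cov} Z => [|z Z IH]; first by rewrite !big_nil measure0.
  rewrite !big_cons; apply: le_trans (leeD2l _ IH).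
  by apply: measureU2 => //; exact: bigsetU_measurable.
apply: (@le_trans _ _ (\sum_(z <- Z) (c ^+ d * vol s (fun=> 2 * rho))%:E)%E).
  by apply: lee_sum => z _; apply: (box_le muE mu_reg).
rewrite sumEFin lee_fin big_const_seq count_predT iter_addr_0 vol_const//.
by rewrite [leRHS]mulr_natl.
Qed.

Definition kernel_cst : R :=
  c ^+ d * 2 `^ S * @packing_cst R d s c * 2 `^ S * D `^ t *
  (1 - 2 `^ t' * 2^-1 `^ t)^-1.

(** The ratio is 2 to the power [t' - t]; here [t' < t] makes the sum over scales converge. *)
Lemma kernel_ratio : 0 <= (2 `^ t' * 2^-1 `^ t : R) < 1.
Proof.
rewrite mulr_ge0 ?powR_ge0//=.
rewrite [in X in _ * X](_ : t = t' + (t - t')); last by ring.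
rewrite powRD ?invr_eq0 ?pnatr_eq0 ?implybT// mulrA -powRM ?invr_ge0//.
rewrite mulfV ?pnatr_eq0// powR1 mul1r.
have half1 : (2^-1 : R) < 1 by rewrite invf_lt1// ltr1n.
have := @gt0_ltr_powR R (t - t') _ 2^-1 1 _ _ half1.
by rewrite powR1; apply; rewrite ?subr_gt0 ?nnegrE ?invr_ge0.
Qed.

Lemma kernel_cst_gt0 : 0 < kernel_cst.
Proof.
have /andP[_ u1] := kernel_ratio.
have cd0 : 0 < c ^+ d by rewrite exprn_gt0// (lt_le_trans _ c_ge1).
have pk0 : 0 < @packing_cst R d s c by exact: packing_cst_gt0.
rewrite mulr_gt0 ?invr_gt0 ?subr_gt0// mulr_gt0 ?powR_gt0// mulr_gt0 ?powR_gt0//.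
by rewrite mulr_gt0// mulr_gt0// powR_gt0.
Qed.

(** Points are counted scale by scale. Those of the doubled rectangle within [dyadic D k] of [x] lie
    in a rectangle whose side radii are minima of [2 * r i] and [dyadic D k], so [packing] and the
    bound [qle] control their proportion by its volume. The cost bound on [phi] turns that volume
    into [vol s r / phi] times the [t]-th power of [dyadic D k], and the kernel weights leave a
    geometric series. *)
Lemma kernel_sum (K : nat) (Z : seq T) (r : 'I_d -> R) (phi : R) (x : T) :
  dist_separated (dyadic D K) Z ->
  (forall y : T, exists2 z, z \in Z & mdist z y <= dyadic D K) ->
  (forall i, dyadic D K <= r i) ->
  0 < phi -> (forall rho, 0 < rho -> phi <= covering_cost r s t rho) ->
  \sum_(y <- Z) (size Z)%:R^-1 * dyadic_kernel D t' K x y *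
     `[< closed_rectangle x (fun i => 2 * r i) y >]%:R <=
  kernel_cst * vol s r / phi.
Proof.
move=> sZ cov rK phi0 phile.
set rho := dyadic D K in sZ cov rK *.
have rho0 : 0 < rho by exact: dyadic_gt0.
have rhoD : rho <= D by have := @le_dyadic R D 0 K D_gt0 (leq0n _);
  rewrite {2}/dyadic expr0 mulr1.
have r0 i : 0 < r i by exact: lt_le_trans (rK i).
have size1 := net_size_ge rho0 cov.
have Z0 : 0 < (size Z)%:R :> R.
  rewrite ltr0n lt0n; apply/negP => /eqP Z0; move: size1.
  by rewrite Z0 mul0r; lra.
set q := (size Z)%:R^-1.
have q0 : 0 < q by rewrite invr_gt0.
have qle : q <= c ^+ d * (2 `^ S * rho `^ S).
  rewrite -[leLHS]mulr1 ler_pdivrMl// -powRM// ?(ltW rho0)//.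
have pk0 : 0 < @packing_cst R d s c by exact: packing_cst_gt0.
have cd0 : 0 < c ^+ d by rewrite exprn_gt0// (lt_le_trans _ c_ge1).
have count_le (k : nat) : (k <= K)%N ->
    \sum_(y <- Z) q * ((mdist x y <= dyadic D k)%R%:R *
       `[< closed_rectangle x (fun i => 2 * r i) y >]%:R) <=
    c ^+ d * 2 `^ S * @packing_cst R d s c * 2 `^ S *
      (vol s r / phi) * dyadic D k `^ t.
  move=> kK; set dk := dyadic D k.
  have dk0 : 0 < dk by exact: dyadic_gt0.
  have rdk : rho <= dk by exact: le_dyadic.
  pose p (y : T) := (mdist x y <= dk) && `[< closed_rectangle x (fun i => 2 * r
    i) y >].
  rewrite -mulr_sumr (_ : \sum_(y <- Z) _ = (size [seq y <- Z | p y])%:R);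
    last first.
    rewrite size_filter -sum1_count natr_sum [RHS]big_mkcond/=.
    by apply: eq_bigr => y _; rewrite -natrM mulnb /p; case: (_ && _).
  pose w i := Num.min (2 * r i) dk.
  have w0 i : 0 < w i by rewrite lt_min dk0 mulr_gt0.
  have rhow i : rho <= w i by rewrite le_min rdk andbT; have := rK i; lra.
  have rhoB : 0 < rho <= D by rewrite rho0.
  have sfZ : dist_separated rho [seq y <- Z | p y].
    have [uZ sepZ] := sZ; split; first exact: filter_uniq.
    by move=> a b; rewrite !mem_filter => /andP[_ aZ] /andP[_ bZ]; exact: sepZ.
  have inw z : z \in [seq y <- Z | p y] -> closed_rectangle x w z.
    rewrite mem_filter => /andP[/andP[xz /asboolP rz] _] i.
    rewrite le_min (rz i)/=.
    by have /(mdist_closed_rectangle _ _ (ltW dk0))/(_ i) := xz.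
  have pack := packing muE c_ge1 mu_reg rhoB rhow sfZ inw.
  rewrite -/(@packing_cst R d s c) in pack.
  (* In each coordinate the minimum times the maximum of [2 * r i] and [dk] is [2 * r i * dk]; the
     minima come from [w], the maxima from the covering cost at radius [dk]. *)
  have volw : vol s w * phi <= 2 `^ S * vol s r * dk `^ t.
    apply: (@le_trans _ _ (vol s w * (vol s (fun i => Num.max (2 * r i) dk) *
        dk `^ (t - S)))).
      rewrite ler_wpM2l ?(ltW (vol_gt0 _ w0))//.
      apply: le_trans (phile _ dk0) _; rewrite ler_wpM2r ?powR_ge0//.
      apply: le_vol => // i; rewrite lt_max dk0 orbT/= ge_max !le_max lexx orbT.
      by have := r0 i; rewrite andbT => ri; apply/orP; left; lra.
    rewrite mulrA [X in X * _](_ : _ = 2 `^ S * vol s r * dk `^ S); last first.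
      rewrite -(@vol_const _ _ s 2)// -(@vol_const _ _ s dk)//.
      rewrite /vol -!big_split/=; apply: eq_bigr => i _.
      have r2 : 0 <= 2 * r i by rewrite mulr_ge0// ltW.
      have mi0 : 0 <= w i by rewrite ltW.
      have ma0 : 0 <= Num.max (2 * r i) dk by rewrite le_max r2.
      rewrite -(powRM _ mi0 ma0) -(powRM _ _ (ltW (r0 i)))// -(powRM _ r2 (ltW
        dk0)).
      by rewrite /w; case: (leP (2 * r i) dk) => _; congr (_ `^ _); ring.
    rewrite -mulrA -powRD ?(gt_eqF dk0) ?implybT//.
    by rewrite addrC subrK.
  apply: (@le_trans _ _ (c ^+ d * (2 `^ S * rho `^ S) * (size [seq y <- Z | p
    y])%:R)).
    by rewrite ler_wpM2r.
  apply: (@le_trans _ _ (c ^+ d * 2 `^ S * (@packing_cst R d s c * vol s w))).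
    rewrite [leLHS](_ : _ = c ^+ d * 2 `^ S *
      ((size [seq y <- Z | p y])%:R * rho `^ S)); last by ring.
    by rewrite ler_wpM2l// mulr_ge0 ?powR_ge0 ?(ltW cd0).
  rewrite -ler_pdivlMr// in volw.
  rewrite [leRHS](_ : _ = c ^+ d * 2 `^ S *
    (@packing_cst R d s c * (2 `^ S * vol s r * dk `^ t / phi))); last by ring.
  rewrite ler_wpM2l ?mulr_ge0 ?powR_ge0 ?(ltW cd0)//.
  by rewrite ler_wpM2l ?(ltW pk0).
have -> : \sum_(y <- Z) q * dyadic_kernel D t' K x y *
     `[< closed_rectangle x (fun i => 2 * r i) y >]%:R =
   \sum_(k < K.+1) (2 `^ t') ^+ k * \sum_(y <- Z) q *
     ((mdist x y <= dyadic D k)%R%:R *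
       `[< closed_rectangle x (fun i => 2 * r i) y >]%:R).
  under eq_bigr do rewrite /dyadic_kernel mulr_sumr mulr_suml.
  rewrite exchange_big/=; apply: eq_bigr => k _; rewrite mulr_sumr.
  by apply: eq_bigr => y _; ring.
pose M := c ^+ d * 2 `^ S * @packing_cst R d s c * 2 `^ S * (vol s r / phi) * D
  `^ t.
have e0 : 0 < vol s r / phi by rewrite divr_gt0// vol_gt0.
have M0 : 0 <= M.
  apply: ltW; apply: mulr_gt0; last exact: powR_gt0.
  apply: mulr_gt0 => //; apply: mulr_gt0; last exact: powR_gt0.
  by apply: mulr_gt0 => //; apply: mulr_gt0 => //; exact: powR_gt0.
apply: (@le_trans _ _ (\sum_(k < K.+1) M * (2 `^ t' * 2^-1 `^ t) ^+ k)).
  apply: ler_sum => k _.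
  apply: (@le_trans _ _ ((2 `^ t') ^+ k * (c ^+ d * 2 `^ S * @packing_cst R d s
    c * 2 `^ S *
      (vol s r / phi) * dyadic D k `^ t))).
    rewrite ler_wpM2l ?exprn_ge0 ?powR_ge0//.
    by apply: count_le; rewrite -ltnS.
  rewrite /dyadic powRM ?exprn_ge0 ?invr_ge0 ?(ltW D_gt0)//.
  have -> : (2^-1 ^+ k : R) `^ t = (2^-1 `^ t) ^+ k.
    by rewrite exprn_powR// invr_ge0.
  by rewrite exprMn /M le_eqVlt; apply/orP; left; apply/eqP; ring.
rewrite -mulr_sumr; apply: (@le_trans _ _ (M * (1 - 2 `^ t' * 2^-1 `^ t)^-1)).
  by rewrite ler_wpM2l// sum_geometric_le// kernel_ratio.
by rewrite /M /kernel_cst le_eqVlt; apply/orP; left; apply/eqP; ring.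
Qed.

End KernelSum.

(** * From bounded energy to a lower bound on the cost of covers *)

Section Content.
Context {R : realType} {T : metricType R}.

(** The first scale that is at most [4 * u] is larger than [2 * u], since scales halve, unless it is
    the scale [D] itself. *)
Lemma dyadic_scale (D u : R) (K : nat) : 0 < D -> dyadic D K <= 4 * u ->
  exists k, [/\ (k <= K)%N, dyadic D k <= 4 * u &
    forall v, v <= D -> v <= 2 * u -> v <= dyadic D k].
Proof.
move=> D0; elim: K => [|K IH] Ku.
  by exists 0%N; split => // v vD _; rewrite /dyadic expr0 mulr1.
have [/IH[k [kK ku vk]]|Kgt] := leP (dyadic D K) (4 * u).
  by exists k; split => //; exact: leqW.
exists K.+1; split => // v _ vu; rewrite dyadicS; move: Kgt; lra.
Qed.

(** Assign each point to the first ball that contains it. A cell of mass [a] has energy at least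
    [a ^+ 2 * k0], where [k0] is the kernel weight at the scale of its ball. The inequality
    [a <= e / k0 + a ^+ 2 * k0 / (4 * e)], a completed square, then sums over the cells to 1/2 <=
    [e] times the cost plus 1/4. *)
Lemma energy_content (D t e : R) (K : nat) (Z : seq T) (nu : T -> R)
    (L : seq (T * R)) :
  0 < D -> (forall x y : T, mdist x y <= D) -> 0 < t -> 0 < e ->
  (forall z, 0 <= nu z) ->
  (forall z, z \in Z -> nu z != 0 -> exists2 l, l \in L & mdist l.1 z < l.2) ->
  (forall l, l \in L -> dyadic D K <= 4 * l.2) ->
  2^-1 <= \sum_(z <- Z) nu z ->
  \sum_(z <- Z) \sum_(y <- Z) dyadic_kernel D t K z y * (nu z * nu y) <= e ->
  4^-1 <= e * \sum_(l <- L) (4 * l.2 / D) `^ t.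
Proof.
move=> D0 dD t0 e0 nu0 cov scale mass_ge en_le.
pose n := size L.
pose inl (l : T * R) (z : T) := mdist l.1 z < l.2.
(* The extra value [n] labels the points outside all balls. Those in [Z] carry no mass, and the
   default of [nth] gives this label the cost 0. *)
pose lab z : 'I_n.+1 := inord (find (fun l => inl l z) L).
have labE z : lab z = find (fun l => inl l z) L :> nat.
  by rewrite inordK// ltnS find_size.
pose en z y := dyadic_kernel D t K z y * (nu z * nu y).
have en0 z y : 0 <= en z y by rewrite mulr_ge0 ?kernel_ge0// mulr_ge0.
pose costs := [seq (4 * l.2 / D) `^ t | l <- L].
pose g (i : 'I_n.+1) := nth 0 costs i.
have gsum : \sum_(i < n.+1) g i = \sum_(l <- L) (4 * l.2 / D) `^ t.
  rewrite big_ord_recr/= /g/= nth_default ?size_map// addr0.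
  by rewrite -[RHS](big_map _ xpredT id) (big_nth 0) size_map big_mkord.
have key (i : 'I_n.+1) : \sum_(z <- Z | lab z == i) nu z <=
    e * g i + (4 * e)^-1 *
      \sum_(z <- Z | lab z == i) \sum_(y <- Z | lab y == i) en z y.
  have RHS0 : 0 <= (4 * e)^-1 *
      \sum_(z <- Z | lab z == i) \sum_(y <- Z | lab y == i) en z y.
    rewrite mulr_ge0 ?invr_ge0 ?mulr_ge0 ?(ltW e0)//.
    by apply: sumr_ge0 => z _; exact: sumr_ge0.
  have [iltn|ni] := ltnP i n; last first.
    rewrite /g nth_default ?size_map// mulr0 add0r big_seq_cond big1// => z
      /andP[zZ /eqP labz].
    apply/eqP/negPn/negP => /(cov _ zZ)[l lL lz].
    have : has (fun l => inl l z) L by apply/hasP; exists l.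
    by rewrite has_find -labE labz ltnNge ni.
  have [l0 l0L] : exists l0, l0 \in L.
    have : (0 < size L)%N by exact: leq_ltn_trans (leq0n i) iltn.
    by case: (L) => // l0 L0 _; exists l0; exact: mem_head.
  pose l := nth l0 L i.
  have gE : g i = (4 * l.2 / D) `^ t.
    by rewrite /g (nth_map l0).
  have lL : l \in L by rewrite mem_nth.
  have near z : lab z == i -> mdist l.1 z < l.2.
    move=> /eqP labz; rewrite -[_ < _]/(inl l z).
    have fi : find (fun l => inl l z) L = i by rewrite -labE labz.
    by rewrite /l -fi; apply: (@nth_find _ l0 (fun l => inl l z));
      rewrite has_find fi.
  have [k [kK ku vk]] := dyadic_scale D0 (scale _ lL).
  pose k0 : R := (2 `^ t) ^+ k.
  have k00 : 0 < k0 by rewrite exprn_gt0// powR_gt0.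
  have gk : k0^-1 <= g i.
    have -> : k0^-1 = (dyadic D k / D) `^ t.
      rewrite /dyadic mulrAC mulfV ?gt_eqF// mul1r exprn_powR ?invr_ge0//.
      rewrite -exprVn; congr (_ ^+ _); rewrite -[in RHS]powR_inv1//.
      by rewrite -powRrM mulN1r powRN.
    rewrite gE; apply: ge0_ler_powR; rewrite ?nnegrE ?(ltW t0)//.
    - by rewrite divr_ge0 ?(ltW D0)// ltW// dyadic_gt0.
    - by rewrite divr_ge0 ?(ltW D0)// (le_trans _ ku)// ltW// dyadic_gt0.
    - by rewrite ler_wpM2r// invr_ge0 ltW.
  set a := \sum_(z <- Z | _) nu z.
  have a0 : 0 <= a by exact: sumr_ge0.
  have enE : a ^+ 2 * k0 <=
      \sum_(z <- Z | lab z == i) \sum_(y <- Z | lab y == i) en z y.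
    rewrite expr2 {1}/a !mulr_suml; apply: ler_sum => z /near lz.
    rewrite /a mulr_sumr mulr_suml; apply: ler_sum => y /near ly.
    rewrite /en mulrC ler_wpM2r ?mulr_ge0//.
    apply: kernel_ge => //; apply: vk => //.
    rewrite (le_trans (metric_triangle _ l.1 _))// [X in X + _]metric_sym.
    by move: lz ly; lra.
  apply: (@le_trans _ _ (e * k0^-1 + (4 * e)^-1 * (a ^+ 2 * k0))); last first.
    rewrite lerD// ler_wpM2l// ?invr_ge0 ?mulr_ge0 ?(ltW e0)//.
  rewrite -subr_ge0.
  rewrite [leRHS](_ : _ = (2 * e - a * k0) ^+ 2 / (4 * e * k0)); last first.
    by field; rewrite !gt_eqF.
  by rewrite divr_ge0 ?sqr_ge0// !mulr_ge0 ?(ltW e0) ?(ltW k00).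
have part (F : T -> R) : \sum_(z <- Z) F z =
    \sum_(i < n.+1) \sum_(z <- Z | lab z == i) F z.
  by rewrite (partition_big lab xpredT).
have le1 : \sum_(z <- Z) nu z <= e * (\sum_(i < n.+1) g i) + (4 * e)^-1 *
    \sum_(i < n.+1) \sum_(z <- Z | lab z == i) \sum_(y <- Z | lab y == i) en z y.
  rewrite part !mulr_sumr -big_split/=; exact: ler_sum.
have le2 : \sum_(i < n.+1) \sum_(z <- Z | lab z == i)
    \sum_(y <- Z | lab y == i) en z y <= e.
  apply: le_trans en_le; rewrite [leRHS]part; apply: ler_sum => i _.
  apply: ler_sum => z _; rewrite [leRHS](bigID (fun y => lab y == i))/= lerDl.
  by apply: sumr_ge0 => y _; exact: (en0 z y).
have le3 : (4 * e)^-1 * (\sum_(i < n.+1) \sum_(z <- Z | lab z == i)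
    \sum_(y <- Z | lab y == i) en z y) <= 4^-1.
  by rewrite ler_pdivrMl ?mulr_gt0// mulrAC mulfV ?mul1r// pnatr_eq0.
by rewrite -gsum; move: mass_ge le1 le3; lra.
Qed.

(** Otherwise, for each [J0], some point of the first [J0] sets avoids the first [J0] balls. A
    cluster point of these lies in every [C j], these being closed, and in none of the balls, these
    being open. *)
Lemma compact_ball_cover (C : nat -> set T) (x : nat -> T) (u : nat -> R) :
  compact [set: T] -> (forall j, closed (C j)) ->
  \bigcap_j C j `<=` \bigcup_l [set y | mdist (x l) y < u l] ->
  exists J0, forall J z, (J0 <= J)%N -> (forall j, (j < J)%N -> C j z) ->
    exists2 l, (l < J0)%N & mdist (x l) z < u l.
Proof.
move=> cT clC cov; apply: contrapT => nocov.
have /choice[z zP] J0 : exists z, (forall j, (j < J0)%N -> C j z) /\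
    forall l, (l < J0)%N -> u l <= mdist (x l) z.
  apply: contrapT => noz; apply: nocov; exists J0 => J z JJ Cz.
  apply: contrapT => nol; apply: noz; exists z; split.
    by move=> j jJ; apply: Cz; exact: leq_trans JJ.
  by move=> l lJ; rewrite leNgt; apply/negP => lz; apply: nol; exists l.
have [|y [_ yz]] := cT (z @ \oo) _; first exact: filterT.
have Cy : (\bigcap_j C j) y.
  move=> j _; move/closure_id : (clC j) => -> B nB.
  have [w [Cw Bw]] : C j `&` B !=set0; last by exists w.
  apply: yz => //; exists j.+1 => // J /= jJ.
  by have [h _] := zP J; exact: h.
have [l _ ly] := cov _ Cy.
have nl : nbhs y [set w | mdist (x l) w < u l].
  apply/metricType_numDomainType.nbhs_mdistP.
  exists (u l - mdist (x l) y); first by rewrite /= subr_gt0.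
  by move=> w /= yw; rewrite (le_lt_trans (metric_triangle _ y _))// -ltrBrDl.
have [w [/= wl lw]] : [set w | u l <= mdist (x l) w] `&`
    [set w | mdist (x l) w < u l] !=set0.
  apply: yz => //; exists l.+1 => // J /= lJ.
  by have [_ h] := zP J; exact: h.
by move: wl; rewrite leNgt lw.
Qed.

(** Each covering set is enlarged to an open ball about one of its points, at the price of a
    summable error in the [t']-cost. Diameters are at most 1, so the [t']-cost is below the
    [t]-cost; this handles all exponents [t <= t'] at once, 0 included. *)
Lemma hausdorff_null_cover (A : set T) (p : T) (t t' eps : R) :
  0 <= t -> t <= t' -> 0 < t' -> 0 < eps -> hausdorff_measure t A = 0%E ->
  exists (x : nat -> T) (u : nat -> R), [/\ forall l, 0 < u l,
    A `<=` \bigcup_l [set y | mdist (x l) y < u l] &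
    forall n, \sum_(l < n) u l `^ t' <= eps].
Proof.
move=> t0 tt' t'0 eps0 HA.
have pre0 : (hausdorff_premeasure t 1 A <= 0)%E.
  by rewrite -HA; apply: ereal_sup_ubound; exists 1 => /=.
have : (hausdorff_premeasure t 1 A < (eps / 2)%:E)%E.
  by rewrite (le_lt_trans pre0)// lte_fin divr_gt0.
move=> /ereal_inf_lt[_ [U [dU AU] <-] sumU].
have /choice[xu xuP] k : exists q : T * R, [/\ 0 < q.2,
    U k `<=` [set y | mdist q.1 y < q.2] &
    ((q.2 `^ t')%:E <= gauge t (U k) + (eps / 2 * 2^-1 ^+ k.+1)%:E)%E].
  have e0 : 0 < eps / 2 * 2^-1 ^+ k.+1.
    by rewrite mulr_gt0 ?divr_gt0// exprn_gt0// invr_gt0.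
  set e := eps / 2 * _ in e0 *.
  have root v : 0 < v -> (v `^ t'^-1) `^ t' = v.
    by move=> v0; rewrite -powRrM mulVf ?gt_eqF// powRr1// ltW.
  have [U0|/set0P[x Ux]] := eqVneq (U k) set0.
    (* Radii must be positive, so an empty set gets a small ball about [p]. *)
    exists (p, e `^ t'^-1); split => /=; first exact: powR_gt0.
      by rewrite U0.
    by rewrite root// U0 gauge_set0 add0e.
  have U0 : U k !=set0 by exists x.
  have dfin : diam (U k) \is a fin_num.
    by rewrite ge0_fin_numE ?diam_ge0// (le_lt_trans (dU k)) ?ltry.
  set dl := fine (diam (U k)).
  have dlE : diam (U k) = dl%:E by rewrite fineK.
  have dl0 : 0 <= dl by rewrite -lee_fin -dlE diam_ge0.
  have dl1 : dl <= 1 by rewrite -lee_fin -dlE.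
  have v0 : 0 < dl `^ t' + e by rewrite ltr_wpDl ?powR_ge0.
  exists (x, (dl `^ t' + e) `^ t'^-1); split => /=; first exact: powR_gt0.
    move=> y Uy /=; apply: (@le_lt_trans _ _ dl).
      by rewrite -lee_fin -dlE; apply: ereal_sup_ubound; exists (x, y).
    rewrite ltNge; apply/negP => le1.
    have : ((dl `^ t' + e) `^ t'^-1) `^ t' <= dl `^ t'.
      by apply: ge0_ler_powR; rewrite ?nnegrE ?powR_ge0// ltW.
    by rewrite root// gerDl leNgt e0.
  rewrite root// EFinD leeD2r// /gauge asboolF; last by move=> h; rewrite h in Ux.
  rewrite dlE -poweR_EFin lee_fin.
  have [->|dlneq] := eqVneq dl 0; first by rewrite powR0 ?gt_eqF// powR_ge0.
  by apply: ger_powR => //; rewrite dl1 andbT lt_neqAle eq_sym dlneq.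
exists (fun k => (xu k).1), (fun k => (xu k).2); split.
- by move=> l; have [] := xuP l.
- by move=> y /AU[l _ Uy]; exists l => //; have [_ h _] := xuP l; exact: h.
move=> n; rewrite -lee_fin -sumEFin.
apply: (@le_trans _ _ (\sum_(l < n) (gauge t (U l) + (eps / 2 * 2^-1 ^+
  l.+1)%:E))%E).
  by apply: lee_sum => l _; have [] := xuP l.
rewrite big_split/=.
rewrite [in leRHS](_ : eps = eps / 2 + eps / 2); last by rewrite -splitr.
rewrite EFinD leeD//.
  apply: le_trans (ltW sumU).
  rewrite -(big_mkord xpredT (fun l => gauge t (U l))).
  by apply: nneseries_lim_ge => k _ _; exact: gauge_ge0.
by rewrite sumEFin lee_fin -mulr_sumr ler_piMr ?sum_half_le1// divr_ge0// ltW.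
Qed.

End Content.

(** The recursion carries the end of the last block and the product of the factors so far. That
    product is fixed before the next block is chosen, so a long enough block beats it; the block's
    own factor [1 + H] matters only to later blocks. *)
Lemma exists_blocks {R : realType} (W H : nat -> nat -> R) (G : nat -> R) :
  (forall p B, exists2 p', (p < p')%N & B <= W p p') ->
  exists N : nat -> nat, (forall j, (N j < N j.+1)%N) /\
    forall j, (\prod_(i < j) (1 + H (N i) (N i.+1))) * G j <= W (N j) (N j.+1).
Proof.
move=> WB.
have /choice[f fP] (pB : nat * R) : exists p', (pB.1 < p')%N /\ pB.2 <= W pB.1 p'.
  by have [p' pp' Bp'] := WB pB.1 pB.2; exists p'.
pose next j (pC : nat * R) :=
  let p' := f (pC.1, pC.2 * G j) in (p', pC.2 * (1 + H pC.1 p')).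
pose st := fix st j := if j is j'.+1 then next j' (st j') else (0%N, 1).
exists (fun j => (st j).1).
have CE j : (st j).2 = \prod_(i < j) (1 + H (st i).1 (st i.+1).1).
  elim: j => [|j IH]; first by rewrite big_ord0.
  by rewrite big_ord_recr/= -IH.
split=> j; first by have [] := fP ((st j).1, (st j).2 * G j).
by rewrite -CE; have [_] := fP ((st j).1, (st j).2 * G j).
Qed.

(** Continuity from below along the increasing intersections. It will bound the event that the
    deviation is large at all late stages. *)
Lemma measure_liminf_le {R : realType} {dsp} {W : measurableType dsp}
    (P : probability W R) (F : nat -> set W) (b : \bar R) :
  (forall n, measurable (F n)) -> (forall n, (P (F n) <= b)%E) ->
  (P (\bigcup_m \bigcap_(n >= m) F n) <= b)%E.
Proof.
move=> mF Fb.
have mI m : measurable (\bigcap_(n >= m) F n).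
  exact: bigcap_measurableType.
have nd : {homo (fun m => \bigcap_(n >= m) F n) : m n / (m <= n)%N >-> (m <= n)%O}.
  move=> m n mn; apply/subsetPset => w h k /= nk; apply: h => /=.
  exact: leq_trans nk.
have cv := nondecreasing_cvg_mu (mu := P) mI (bigcup_measurable (fun n _ => mI
  n)) nd.
rewrite -(cvg_lim _ cv)//; apply: lime_le; first by apply/cvg_ex; eexists;
  exact: cv.
near=> m; apply: le_trans (Fb m); apply: le_measure; rewrite ?inE//.
by move=> w; apply => /=.
Unshelve. all: by end_near.
Qed.

Lemma closed_rectangle_closed {R : realType} {I : finType}
    (X : I -> metricType R) (x : metric_prod X) (w : I -> R) :
  closed (closed_rectangle x w).
Proof.
rewrite -[X in closed X]setCK; apply: open_closedC;
  rewrite openE => y /= /existsNP[i /negP]; rewrite -ltNge => wi.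
rewrite /interior; apply/metricType_numDomainType.nbhs_mdistP.
exists (mdist (x i) (y i) - w i); first by rewrite /= subr_gt0.
move=> z /= yz zw.
have yzi : mdist (y i) (z i) <= mdist y z.
  exact: ((mdist_closed_rectangle y z (mdist_ge0 y z)).1 (lexx _) i).
have := metric_triangle (x i) (z i) (y i); have := zw i.
by rewrite [mdist (z i) _]metric_sym; lra.
Qed.

Lemma dyadic_small {R : realType} (D e : R) : 0 < D -> 0 < e ->
  exists k, dyadic D k <= e.
Proof.
move=> D0 e0; pose k := (Num.trunc (D / e)).+1; exists k.
have ke : D / e < k%:R by rewrite /k truncnS_gt.
have k2 : (k%:R : R) <= 2 ^+ k.
  by rewrite -natrX ler_nat ltnW// ltn_expl.
rewrite /dyadic exprVn ler_pdivrMr ?exprn_gt0// mulrC -ler_pdivrMr//.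
exact: le_trans (ltW ke) k2.
Qed.

Lemma dyadic_small_seq {R : realType} (I : eqType) (l : seq I) (f : I -> R)
    (D : R) : 0 < D -> (forall i, 0 < f i) ->
  exists k0, forall k i, (k0 <= k)%N -> i \in l -> dyadic D k <= f i.
Proof.
move=> D0 f0; elim: l => [|i l [k1 IH]]; first by exists 0%N.
have [k2 k2P] := dyadic_small D0 (f0 i); exists (maxn k1 k2) => k j.
rewrite geq_max => /andP[k1k k2k]; rewrite inE => /orP[/eqP->|]; last exact: IH.
by apply: le_trans k2P; exact: le_dyadic.
Qed.

(** * The lower bound outside an event of small probability *)

Section LowerBound.
Context {R : realType} {d : nat} {X : 'I_d -> pointedMetricType R}.
Context {s : 'I_d -> R} {mu_ : forall i, probability (borelType (X i)) R}.
Context {mu : probability (product_space (fun i => borelType (X i))) R}.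
Local Notation V := (product_space (fun i => borelType (X i))).
Local Notation Omega := (product_space (fun _ : nat => V)).
Context {P : probability Omega R} {c D : R}.
Hypothesis muE : is_product_measure mu_ mu.
Hypothesis PE : is_product_measure (fun _ : nat => mu) P.
Hypothesis d_gt0 : (0 < d)%N.
Hypothesis X_compact : forall i, compact [set: X i].
Hypothesis s_ge0 : forall i, 0 <= s i.
Hypothesis c_ge1 : 1 <= c.
Hypothesis D_gt0 : 0 < D.
Hypothesis mu_reg : forall i, ball_regular (mu_ i) (s i) c D.
Hypothesis mdist_le : forall i (x y : X i), mdist x y <= D.
Local Notation T := (metric_prod X).
Local Notation S := (\sum_i s i).
Variables (r : nat -> 'I_d -> R) (t t' : R).
Hypothesis r_dom : forall n i, 0 < r n i <= D.
Hypothesis t_dom : 0 <= t <= S.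
Hypothesis t'_gt0 : 0 < t'.
Hypothesis tt' : t' < t.
Local Notation Phi n := (singular_value (r n) s t).
Local Notation kernel_cst := (@kernel_cst R d s c D t t').

(** To be read as a set of centres: by symmetry of the metric, the [n]-th rectangle contains [x] if
    and only if its centre lies in the rectangle of the same side radii about [x]. *)
Definition rect (n : nat) (x : T) : set V := closed_rectangle x (r n).

Let r_gt0 n i : 0 < r n i. Proof. by have /andP[] := r_dom n i. Qed.
Let cd_gt0 : 0 < c ^+ d. Proof. by rewrite exprn_gt0// (lt_le_trans _ c_ge1). Qed.

Let Phi_gt0 n : 0 < Phi n.
Proof. exact: (@singular_value_gt0 R d (r n) s t). Qed.

Lemma measurable_rect n x : measurable (rect n x).
Proof. exact: measurable_closed_rectangle. Qed.

Lemma hit_rect_ge n x : (c ^+ d)^-1 * vol s (r n) <= hit_prob (mu := mu) rect n x.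
Proof.
rewrite -lee_fin /hit_prob fineK; last exact: fin_num_measure (measurable_rect n x).
apply: le_trans (box_ge muE c_ge1 mu_reg x (r_dom n)) _.
apply: le_measure; rewrite ?inE.
- exact: measurable_box_ball.
- exact: measurable_rect.
- by move=> y xy i; have := xy i; rewrite ballEmdist/= => /ltW.
Qed.

Lemma hit_rect_gt0 n x : 0 < hit_prob (mu := mu) rect n x.
Proof.
by apply: lt_le_trans (hit_rect_ge n x); rewrite mulr_gt0 ?invr_gt0// vol_gt0.
Qed.

(** Rectangles about [x] and [y] meet only if [y] lies in the doubled rectangle about [x]. The mass
    of the intersection then cancels one hit probability, and [hit_rect_ge] bounds the other. *)
Lemma correlation_rect_le (a : nat -> nat -> R) (N : nat -> nat) j x y :
  correlation (mu := mu) rect a N j x y <=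
  \sum_(N j <= n < N j.+1) a j n ^+ 2 *
    (`[< closed_rectangle x (fun i => 2 * r n i) y >]%:R * (c ^+ d / vol s (r n))).
Proof.
apply: ler_sum => n _; rewrite ler_wpM2l ?sqr_ge0//.
have hx := hit_rect_gt0 n x; have hy := hit_rect_gt0 n y.
have v0 := vol_gt0 s (r_gt0 n).
case: asboolP => [_|far]; last first.
  rewrite (_ : rect n x `&` rect n y = set0) ?measure0 ?mul0r//.
  apply/seteqP; split => // z [xz yz]; apply: far => i.
  rewrite (le_trans (metric_triangle _ (z i) _))//.
  by have := xz i; have := yz i; rewrite [mdist (z i) _]metric_sym; lra.
rewrite mul1r; apply: (@le_trans _ _ (hit_prob (mu := mu) rect n y)^-1).
  rewrite invfM mulrA -[leRHS]mul1r ler_wpM2r ?invr_ge0 ?(ltW hy)//.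
  rewrite ler_pdivrMr// mul1r fine_le//.
  - by apply: fin_num_measure; apply: measurableI; exact: measurable_rect.
  - exact: fin_num_measure (measurable_rect n x).
  apply: le_measure; rewrite ?inE; last exact: subIsetl.
  - by apply: measurableI; exact: measurable_rect.
  - exact: measurable_rect.
rewrite -[leRHS]invrK lef_pV2 ?posrE ?invr_gt0 ?divr_gt0//.
by rewrite invf_div mulrC; exact: hit_rect_ge.
Qed.

(** A null limsup set would have a cover of small [t']-cost. By compactness finitely many of its
    balls cover the support of every late density, in particular of one with small deviation at a
    stage whose cut-off scale is finer than these balls; [energy_content] then gives a
    contradiction. *)
Lemma limsup_rect_not_null (a : nat -> nat -> R) (N K : nat -> nat)
    (Z : nat -> seq T) (eta t'' : R) (w : Omega) :
  (forall j n, 0 <= a j n) -> (forall j, (N j < N j.+1)%N) ->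
  (forall J, (J <= K J)%N) -> 0 < eta <= 1 ->
  (forall J0, exists2 J, (J0 <= J)%N &
    deviation (mu := mu) rect a N (Z J) (size (Z J))%:R^-1
      (dyadic_kernel D t' (K J)) eta J w < 4^-1) ->
  0 <= t'' <= t' ->
  hausdorff_measure t''
    (lim_sup_set (fun n => @closed_rectangle R 'I_d X (w n) (r n))) <> 0%E.
Proof.
move=> a0 Nlt JK eta01 often /andP[t''0 t''t'] null.
have /andP[eta0 eta1] := eta01.
pose C j : set T := \bigcup_(n in [set n | (N j <= n < N j.+1)%N])
  closed_rectangle (w n : T) (r n).
have Cclosed j : closed (C j).
  apply: closed_bigcup => [|n _]; last exact: closed_rectangle_closed.
  apply: (@sub_finite_set _ _ `I_(N j.+1)); last exact: finite_II.
  by move=> n /= /andP[].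
have N_ge m : (m <= N m)%N.
  by elim: m => // m IH; exact: leq_ltn_trans IH (Nlt m).
have CA : \bigcap_j C j `<=`
    lim_sup_set (fun n => @closed_rectangle R 'I_d X (w n) (r n)).
  move=> y Cy m _; have [n /andP[Nn _] yn] := Cy m I.
  by exists n => //=; exact: leq_trans (N_ge m) Nn.
pose Q := (4 / D) `^ t'; have Q0 : 0 < Q by rewrite powR_gt0// divr_gt0.
(* [Q] converts powers of [u l] into powers of [4 * u l / D]; with this [eps] the cover would give
   1/4 <= 1/8. *)
pose eps := eta / (2 * Q).
have eps0 : 0 < eps by rewrite divr_gt0// mulr_gt0.
pose p0 : T := fun i => (point : X i).
have [x [u [u0 cov sumu]]] :=
  hausdorff_null_cover p0 t''0 t''t' t'_gt0 eps0 null.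
have Tcompact := compact_metric_prod X_compact.
have [J0 J0P] := compact_ball_cover Tcompact Cclosed (subset_trans CA cov).
have [k0 k0P] := dyadic_small_seq (iota 0 J0) D_gt0
  (fun l => mulr_gt0 (ltr0Sn R 3) (u0 l)).
have [J JJ dev] := often (maxn J0 k0).
move: JJ; rewrite geq_max => /andP[J0J k0J].
have TD (y z : T) : mdist y z <= D.
  by apply/(mdist_closed_rectangle y z (ltW D_gt0)) => i; exact: mdist_le.
have [mass_ge en_le] := deviation_lt hit_rect_gt0 a0 eta01
  (fun y z => kernel_ge1 t' (K J) (TD y z)) dev.
pose q : R := (size (Z J))%:R^-1.
pose nu z := q * density (mu := mu) rect a N J z w.
have dens0 z : 0 <= density (mu := mu) rect a N J z w.
  by apply: density_ge0 => //; exact: hit_rect_gt0.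
have := @energy_content R T D t' (4 * eta)^-1 (K J) (Z J) nu
  [seq (x l, u l) | l <- iota 0 J0] D_gt0 TD t'_gt0 _ _ _ _ mass_ge _.
rewrite big_map (eq_bigr (fun l => Q * u l `^ t')); last first.
  move=> l _ /=; rewrite /Q -powRM ?(ltW (u0 l)) ?divr_ge0 ?(ltW D_gt0)//.
  by congr (_ `^ _); ring.
rewrite -mulr_sumr => concl.
have : 4^-1 <= (4 * eta)^-1 * (Q * eps).
  apply: le_trans (concl _ _ _ _ _) _.
  - by rewrite invr_gt0 mulr_gt0.
  - by move=> z; rewrite mulr_ge0// invr_ge0.
  - move=> z _ nuz; have dz : density (mu := mu) rect a N J z w != 0.
      by apply: contra nuz => /eqP h; rewrite /nu h mulr0.
    have [j jJ|l lJ0 lz] := J0P J z J0J.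
      have [n nj zn] := density_neq0 dz jJ; exists n => // i.
      by rewrite metric_sym; exact: zn.
    by exists (x l, u l) => //; apply/mapP; exists l => //; rewrite mem_iota.
  - move=> _ /mapP[l lJ0 ->] /=; apply: k0P => //.
    exact: leq_trans k0J (JK J).
  - apply: le_trans en_le; apply: ler_sum => z _; apply: ler_sum => y _.
    by rewrite /nu le_eqVlt; apply/orP; left; apply/eqP; rewrite /q; ring.
  - rewrite ler_wpM2l ?invr_ge0 ?mulr_ge0 ?(ltW eta0)// ler_wpM2l ?(ltW Q0)//.
    by have := sumu J0;
      rewrite -(big_mkord xpredT (fun l => u l `^ t')) /index_iota subn0.
rewrite (_ : (4 * eta)^-1 * (Q * eps) = 8^-1); last first.
  by rewrite /eps; field; rewrite !gt_eqF.
by lra.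
Qed.

(** The constant [4 * (K + 2)] of [deviation_prob], with [K] the bound of [kernel_sum] for side
    radii [D]: such a rectangle is the whole space, so the entire kernel is summed. *)
Definition exceptional_cst : R :=
  4 * (kernel_cst * vol s (fun=> D) / singular_value (fun=> D) s t + 2).

(** [E] is the event that the deviation is at least 1/4 at all late stages; outside it small
    deviations recur, which is what [limsup_rect_not_null] needs. *)
Lemma exceptional_event (eta : R) : 0 < eta <= 1 ->
  (forall p B, exists2 p', (p < p')%N & B <= \sum_(p <= n < p') Phi n) ->
  exists E : set Omega, [/\ measurable E, (P E <= (eta * exceptional_cst)%:E)%E &
    forall w, ~ E w -> forall t'', 0 <= t'' <= t' ->
    hausdorff_measure t''
      (lim_sup_set (fun n => @closed_rectangle R 'I_d X (w n) (r n))) <> 0%E].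
Proof.
move=> eta01 Phi_div; have /andP[eta0 eta1] := eta01.
have kc0 : 0 < kernel_cst := kernel_cst_gt0 c_ge1 D_gt0 tt'.
pose W p p' := \sum_(p <= n < p') Phi n.
(* A crude bound for the correlation of a block, uniform in the two points: the indicator of
   [correlation_rect_le] is replaced by 1. *)
pose Hf p p' := \sum_(p <= n < p') (Phi n / W p p') ^+ 2 * (c ^+ d / vol s (r n)).
(* Chosen so that [NW] makes the earlier factors times [c ^+ d * kernel_cst / Wj j] at most
   [eta * 2^-1 ^+ j.+1], as [deviation_prob] requires. *)
pose G j := c ^+ d * kernel_cst / eta * 2 ^+ j.+1.
have [N [Nlt NW]] := exists_blocks (W := W) Hf G Phi_div.
pose Wj j := W (N j) (N j.+1).
have W0 j : 0 < Wj j.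
  rewrite /Wj /W big_ltn// ltr_pwDl// sumr_ge0// => n _; exact: ltW.
pose a j n := Phi n / Wj j.
have a0 j n : 0 <= a j n by rewrite divr_ge0// ltW.
have suma j : \sum_(N j <= n < N j.+1) a j n = 1.
  by rewrite /a -mulr_suml -/(W _ _) -/(Wj j) mulfV// gt_eqF.
have N_le i j : (i <= j)%N -> (N i <= N j)%N.
  move=> /subnK <-; elim: (j - i)%N => [|k IH]; first by rewrite add0n.
  by rewrite addSn; exact: leq_trans IH (ltnW (Nlt _)).
have TD (y z : T) : mdist y z <= D.
  by apply/(mdist_closed_rectangle y z (ltW D_gt0)) => i; exact: mdist_le.
pose p0 : T := fun i => (point : X i).
(* The net of stage [J] is finer than all rectangles before [N J], for [kernel_sum]; its scale index
   is at least [J], so that late stages resolve any given finite family of balls. *)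
have /choice[KZ KZP] J : exists KZ : nat * seq T, [/\ (J <= KZ.1)%N,
    dist_separated (dyadic D KZ.1) KZ.2,
    forall y : T, exists2 z, z \in KZ.2 & mdist z y <= dyadic D KZ.1 &
    forall n i, (n < N J)%N -> dyadic D KZ.1 <= r n i].
  pose l := [seq (n, i) | n <- iota 0 (N J), i <- enum 'I_d].
  have [k0 k0P] := dyadic_small_seq l D_gt0 (fun p => r_gt0 p.1 p.2).
  pose K := maxn J k0.
  have rhoD : 0 < dyadic D K <= D.
    rewrite dyadic_gt0//=; have := @le_dyadic R D 0 K D_gt0 (leq0n _).
    by rewrite {2}/dyadic expr0 mulr1.
  have [] := rectangle_net muE c_ge1 mu_reg (A := setT) (x := p0) (w := fun=>
    D) rhoD.
  - by move=> _; case/andP : rhoD.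
  - by move=> y _ i; exact: mdist_le.
  move=> Z [sZ _ cov _]; exists (K, Z); split => //=.
  - exact: leq_maxl.
  - by move=> y; exact: cov.
  - move=> n i nN; apply: (k0P K (n, i)); first exact: leq_maxr.
    by apply: allpairs_f; rewrite ?mem_iota// mem_enum.
pose K J := (KZ J).1; pose Z J := (KZ J).2; pose q J : R := (size (Z J))%:R^-1.
pose kap J := dyadic_kernel (T := T) D t' (K J).
pose Y J := deviation (mu := mu) rect a N (Z J) (q J) (kap J) eta J.
have q_size J : q J * (size (Z J))%:R = 1.
  have [_ _ cov _] := KZP J.
  rewrite /q mulVf//; apply/negP => /eqP size0.
  have := net_size_ge muE mu_reg (dyadic_gt0 (K J) D_gt0) cov.
  by rewrite size0 mul0r; lra.
have kap1 J y z : 1 <= kap J y z by exact: kernel_ge1.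
have row J n x : (n < N J)%N ->
    \sum_(y <- Z J) q J * kap J x y *
      `[< closed_rectangle x (fun i => 2 * r n i) y >]%:R <=
    kernel_cst * vol s (r n) / Phi n.
  move=> nN; have [_ sZ cov small] := KZP J.
  apply: (kernel_sum muE s_ge0 c_ge1 D_gt0 mu_reg tt' x sZ cov) => //.
    by move=> i; exact: small.
  by move=> rho rho0; exact: singular_value_le.
pose PhiD := singular_value (fun=> D) s t.
have PhiD0 : 0 < PhiD by exact: (@singular_value_gt0 R d (fun=> D) s t).
have sum_q J : \sum_(x <- Z J) q J = 1.
  by rewrite big_const_seq count_predT iter_addr_0 -[LHS]mulr_natr q_size.
have sum_avg J (F : T -> R) (m : R) : (forall x, F x <= m) ->
    \sum_(x <- Z J) q J * F x <= m.
  move=> Fm; rewrite -[leRHS]mul1r -(sum_q J) mulr_suml; apply: ler_sum => x _.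
  by rewrite ler_wpM2l// invr_ge0.
have kap_sum J : \sum_(x <- Z J) \sum_(y <- Z J) q J ^+ 2 * kap J x y <=
    kernel_cst * vol s (fun=> D) / PhiD.
  rewrite (eq_bigr (fun x => q J * \sum_(y <- Z J) q J * kap J x y)); last first.
    by move=> x _; rewrite mulr_sumr; apply: eq_bigr => y _; rewrite expr2 mulrA.
  apply: sum_avg => x; have [_ sZ cov _] := KZP J.
  have := kernel_sum (r := fun=> D) (phi := PhiD) muE s_ge0 c_ge1 D_gt0 mu_reg
    tt' x sZ cov _ PhiD0 _.
  rewrite (eq_bigr (fun y => q J * kap J x y)); last first.
    move=> y _; rewrite asboolT ?mulr1// => i.
    by rewrite (le_trans (mdist_le _ _))// ler_peMl ?(ltW D_gt0)// ler1n.
  apply=> [i|rho rho0]; last exact: singular_value_le.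
  have := @le_dyadic R D 0 (K J) D_gt0 (leq0n _).
  by rewrite {2}/dyadic expr0 mulr1.
pose H j := Hf (N j) (N j.+1).
have corr_le j x y : correlation (mu := mu) rect a N j x y <= H j.
  apply: le_trans (correlation_rect_le _ _ _ _ _) _; apply: ler_sum => n _.
  rewrite ler_wpM2l ?sqr_ge0// ler_piMl//; last by case: asboolP.
  by rewrite divr_ge0// ?(ltW cd_gt0)// ltW// vol_gt0.
have corr_sum J j : (j < J)%N -> (\prod_(i < j) (1 + H i)) *
    (\sum_(x <- Z J) \sum_(y <- Z J)
      q J ^+ 2 * kap J x y * correlation (mu := mu) rect a N j x y) <=
    eta * 2^-1 ^+ j.+1.
  move=> jJ.
  have H0 i : 0 <= H i.
    by apply: le_trans (corr_le i p0 p0); apply: correlation_ge0;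
      exact: hit_rect_gt0.
  have C0 : 0 <= \prod_(i < j) (1 + H i).
    by apply: prodr_ge0 => i _; rewrite addr_ge0.
  have le1 : \sum_(x <- Z J) \sum_(y <- Z J)
      q J ^+ 2 * kap J x y * correlation (mu := mu) rect a N j x y <=
      c ^+ d * kernel_cst / Wj j.
    pose b n := a j n ^+ 2 * (c ^+ d / vol s (r n)).
    have b0 n : 0 <= b n.
      by rewrite mulr_ge0 ?sqr_ge0// divr_ge0 ?(ltW cd_gt0)// ltW// vol_gt0.
    apply: (@le_trans _ _ (\sum_(x <- Z J) q J *
        \sum_(N j <= n < N j.+1) b n * \sum_(y <- Z J) q J * kap J x y *
          `[< closed_rectangle x (fun i => 2 * r n i) y >]%:R)).
      apply: ler_sum => x _.
      under [in leRHS]eq_bigr do rewrite mulr_sumr.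
      rewrite exchange_big/= mulr_sumr; apply: ler_sum => y _.
      have qk0 : 0 <= q J ^+ 2 * kap J x y.
        by rewrite mulr_ge0 ?sqr_ge0// (le_trans ler01).
      apply: le_trans (ler_wpM2l qk0 (correlation_rect_le _ _ _ _ _)) _.
      rewrite mulr_sumr [leRHS]mulr_sumr; apply: ler_sum => n _.
      rewrite /b le_eqVlt; apply/orP; left; apply/eqP; ring.
    apply: sum_avg => x.
    (* The row bound cancels the volume and one of the two factors [Phi n] in [a j n ^+ 2]. A single
       weight [a j n] remains, and the weights sum to 1. *)
    apply: (@le_trans _ _ (\sum_(N j <= n < N j.+1)
        c ^+ d * kernel_cst / Wj j * a j n)).
      rewrite big_nat [leRHS]big_nat; apply: ler_sum => n /andP[_ nj].
      apply: le_trans (ler_wpM2l (b0 n) (row J n x _)) _.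
        exact: leq_trans nj (N_le _ _ jJ).
      rewrite le_eqVlt; apply/orP; left; apply/eqP; rewrite /b /a.
      have v0 := vol_gt0 s (r_gt0 n).
      by field; rewrite !gt_eqF.
    by rewrite -mulr_sumr suma mulr1.
  apply: le_trans (ler_wpM2l C0 le1) _.
  have := NW j; rewrite -/(Wj j) -/(H _) => NWj.
  rewrite mulrA ler_pdivrMr// exprVn mulrAC ler_pdivlMr ?exprn_gt0//.
  rewrite -ler_pdivrMl//; apply: le_trans NWj.
  by rewrite /G /H le_eqVlt; apply/orP; left; apply/eqP; ring.
have F_prob J : (P [set w | (4^-1 <= Y J w)%R] <= (eta * exceptional_cst)%:E)%E.
  have := deviation_prob PE (A := rect) (a := a) (N := N) measurable_rect
    hit_rect_gt0 a0
    (fun j => ltnW (Nlt j)) suma (q_size J) eta01 (kap1 J) (kap_sum J) corr_le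
    (corr_sum J).
  by rewrite /exceptional_cst mulrCA; exact.
have mF J : measurable [set w | 4^-1 <= Y J w].
  rewrite -[X in measurable X]setTI.
  have -> : [set w | 4^-1 <= Y J w] = Y J @^-1` `[4^-1, +oo[.
    by apply/seteqP; split => w /=; rewrite in_itv/= andbT.
  have [mY _] : bounded_measurable (Y J).
    apply: deviation_bounded_measurable.
    - exact: measurable_rect.
    - by move=> j; exact: ltnW.
  by apply: mY => //; exact: measurable_itv.
exists (\bigcup_m \bigcap_(J >= m) [set w | 4^-1 <= Y J w]); split.
- by apply: bigcup_measurable => m _; exact: bigcap_measurableType.
- exact: measure_liminf_le.
move=> w nE t'' t''01.
apply: (@limsup_rect_not_null a N K Z eta t'' w a0 Nlt _ eta01 _ t''01).
  by move=> J; have [] := KZP J.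
move=> J0; apply: contrapT => none; apply: nE; exists J0 => // J /= J0J.
by rewrite leNgt; apply/negP => dev; apply: none; exists J.
Qed.

End LowerBound.

(** * Uniform constants and exhaustion by countably many exponents *)

Lemma uniform_constants {R : realType} (d : nat)
    (X : 'I_d -> pointedMetricType R) (s : 'I_d -> R)
    (mu_ : forall i, probability (borelType (X i)) R) (M : R) :
  (forall i, compact [set: X i]) ->
  (forall i, regular_measure (mu_ i) (s i)) ->
  (forall i, 0 < s i -> (0 < diam [set: X i])%E) ->
  exists D c, [/\ M <= D, 0 < D, forall i (x y : X i), mdist x y <= D, 1 <= c &
    forall i, ball_regular (mu_ i) (s i) c D].
Proof.
move=> cX reg nondeg.
have /choice[f fP] i := compact_mdist_bounded (cX i).
(* Sums of absolute values stand in for maxima; [M] enters so that [D] also bounds the side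
   radii. *)
pose D := 1 + `|M| + \sum_i `|f i|.
have sum0 : 0 <= \sum_i `|f i| by apply: sumr_ge0.
have D0 : 0 < D by rewrite ltr_pwDl// ltr_pwDl.
have fD i : f i <= D.
  rewrite (le_trans (ler_norm _))// /D (bigD1 i)//= addrCA lerDl.
  by rewrite addr_ge0 ?sumr_ge0// addr_ge0.
have dD i (x y : X i) : mdist x y <= D by exact: le_trans (fP i x y) (fD i).
have /choice[g gP] i :=
  regular_measure_bounded_radii (dD i) (reg i) (nondeg i) D0.
have g1 i : 1 <= g i by have [] := gP i.
have g0 i : 0 <= g i by exact: le_trans (g1 i).
exists D, (1 + \sum_i g i); split => //.
- rewrite (le_trans (ler_norm _))// /D -addrA addrCA lerDl.
  by rewrite addr_ge0.
- by rewrite lerDl sumr_ge0.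
- move=> i; have [_] := gP i; apply: ball_regularW.
    exact: lt_le_trans (g1 i).
  rewrite (bigD1 i)//= addrCA lerDl addr_ge0// sumr_ge0//.
Qed.

Lemma divergent_blocks {R : realType} (f : nat -> R) :
  (forall n, 0 <= f n) -> ~ (\sum_(0 <= n <oo) (f n)%:E < +oo)%E ->
  forall p B, exists2 p', (p < p')%N & B <= \sum_(p <= n < p') f n.
Proof.
move=> f0 foo p B; apply: contrapT => nop; apply: foo.
have bnd p' : (p < p')%N -> \sum_(p <= n < p') f n <= B.
  move=> pp'; rewrite leNgt; apply/negP => Bp; apply: nop; exists p' => //.
  exact: ltW.
apply: (@le_lt_trans _ _ (\sum_(0 <= n < p) f n + B)%:E); last exact: ltry.
apply: lime_le.
  by apply: is_cvg_nneseries => n _ _; rewrite lee_fin.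
apply: nearW => n; rewrite sumEFin lee_fin.
pose m := maxn n p.+1.
apply: (@le_trans _ _ (\sum_(0 <= k < m) f k)).
  by rewrite [leRHS](big_cat_nat (n := n)) ?leq_maxl//= lerDl sumr_ge0.
have pm : (p < m)%N by exact: leq_maxr.
by rewrite (big_cat_nat (n := p)) ?(ltnW pm)//= lerD2l bnd.
Qed.

Lemma negligible_of_small_covers {R : realType} {dsp} {W : measurableType dsp}
    (P : probability W R) (A : set W) (M : R) :
  (forall eta, 0 < eta <= 1 -> exists E : set W, [/\ measurable E,
    (P E <= (eta * M)%:E)%E & A `<=` E]) -> P.-negligible A.
Proof.
move=> small.
have /choice[E EP] k : exists E : set W, [/\ measurable E,
    (P E <= ((k.+1%:R)^-1 * M)%:E)%E & A `<=` E].
  by apply: small; rewrite invr_gt0 ltr0n/= invf_le1 ?ltr0n// ler1n.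
have mE : measurable (\bigcap_k E k).
  by apply: bigcap_measurableType => k _; have [] := EP k.
exists (\bigcap_k E k); split => //; last first.
  by move=> w Aw k _; have [_ _] := EP k; exact.
apply/eqP; rewrite eq_le measure_ge0 andbT; apply/lee_addgt0Pr => e e0.
rewrite add0e; pose k := Num.trunc (`|M| / e).
have [mEk PEk _] := EP k.
apply: (@le_trans _ _ (P (E k))).
  by apply: le_measure; rewrite ?inE//; apply: bigcap_inf.
apply: le_trans PEk _; rewrite lee_fin mulrC ler_pdivrMr ?ltr0n//.
rewrite (le_trans (ler_norm _))// mulrC -ler_pdivrMr// ltW//.
by rewrite /k truncnS_gt.
Qed.

Theorem theorem1 (R : realType) (d : nat) (d_gt0 : (0 < d)%N)
  (X : 'I_d -> pointedMetricType R)
  (X_compact : forall i, compact [set: X i])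
  (s : 'I_d -> R)
  (mu_ : forall i, probability (borelType (X i)) R)
  (mu_regular : forall i, regular_measure (mu_ i) (s i))
  (X_nondegenerate : forall i, 0 < s i -> (0 < diam [set: X i])%E)
  (mu : probability (product_space (fun i => borelType (X i))) R)
  (muE : is_product_measure mu_ mu)
  (P : probability
         (product_space
            (fun _ : nat => product_space (fun i => borelType (X i)))) R)
  (PE : is_product_measure (fun _ : nat => mu) P)
  (r : nat -> 'I_d -> R)
  (r_gt0 : forall n i, 0 < r n i)
  (r_bounded : exists M : R, forall n i, r n i <= M) :
  {ae P, forall omega,
     hausdorff_dim (lim_sup_set (fun n =>
       @closed_rectangle R 'I_d X (omega n) (r n)))
     = Order.min (critical_exponent r s) (\sum_i s i)%:E}.
Proof.
have [M rM] := r_bounded.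
have [D [c [MD D0 dD c1 mu_reg]]] :=
  uniform_constants M X_compact mu_regular X_nondegenerate.
have s0 i : 0 <= s i by have [] := mu_regular i.
have r_dom n i : 0 < r n i <= D by rewrite r_gt0 (le_trans (rM n i)).
pose A (w : nat -> metric_prod X) :=
  lim_sup_set (fun n => @closed_rectangle R 'I_d X (w n) (r n)).
set S := \sum_i s i.
have S0 : 0 <= S by exact: sumr_ge0.
set m := Order.min _ _.
have upper w : (hausdorff_dim (A w) <= m)%E.
  rewrite le_min; apply/andP; split.
    apply: le_ereal_inf => _ [t [tS sumoo] <-]; exists t => //; split.
      by have /andP[] := tS.
    exact: (limsup_hausdorff_measure0 muE s0 c1 mu_reg D0).
  apply/lee_addgt0Pr => e e0; apply: ereal_inf_lbound; exists (S + e) => //.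
  split; first by rewrite addr_ge0// ltW.
  by apply: (hausdorff_measure0_above muE s0 c1 mu_reg D0 _ dD) => //;
    rewrite ltrDl.
have dim_ge0 w : (0 <= hausdorff_dim (A w))%E.
  by apply: le_ereal_inf_tmp => _ [t [t0 _] <-]; rewrite lee_fin.
have m_ge0 : (0 <= m)%E.
  rewrite le_min lee_fin S0 andbT.
  by apply: le_ereal_inf_tmp => _ [t [/andP[t0 _] _] <-]; rewrite lee_fin.
have m_fin : m \is a fin_num.
  by rewrite ge0_fin_numE// (@le_lt_trans _ _ S%:E) ?ltry// ge_min lexx orbT.
pose m0 := fine m; have mE : m = m0%:E by rewrite fineK.
have m0S : m0 <= S by rewrite -lee_fin -mE ge_min lexx orbT.
have m0_ge0 : 0 <= m0 by rewrite -lee_fin -mE.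
(* For [m0 = 0] the upper bound and [dim_ge0] already decide. *)
have [m0_gt0|m0_le0] := ltP 0 m0; last first.
  apply: aeW => w; apply/eqP; rewrite eq_le upper/= mE.
  by apply: le_trans (dim_ge0 w); rewrite lee_fin.
(* Countably many exponents increasing to [m0], so that the exceptional sets can be united; [l.+2]
   makes [lev 0 = m0 / 2] positive. Consecutive ones serve as the [t'] and [t] of the lower
   bound. *)
pose lev (l : nat) := m0 - m0 / l.+2%:R.
have lev_gt0 l : 0 < lev l.
  by rewrite subr_gt0 ltr_pdivrMr ?ltr0n// ltr_pMr// ltr1n.
have lev_lt l : lev l < lev l.+1.
  by rewrite ltrD2l ltrN2 ltr_pM2l// ltf_pV2 ?posrE ?ltr0n// ltr_nat.
have lev_lt_m0 l : lev l < m0 by rewrite ltrBlDr ltrDl divr_gt0// ltr0n.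
have lower l : {ae P, forall w, forall t, 0 <= t <= lev l ->
    hausdorff_measure t (A w) <> 0%E}.
  have tS : 0 <= lev l.+1 <= S.
    by rewrite ltW//= (le_trans (ltW (lev_lt_m0 _))).
  have Phi_div := divergent_blocks
    (fun n => ltW (singular_value_gt0 d_gt0 (r_gt0 n) s0 tS)).
  apply: (@negligible_of_small_covers _ _ _ _ _
    (@exceptional_cst R d s c D (lev l.+1) (lev l))) => eta eta01.
  have [|E [mEE PEE nE]] := exceptional_event muE PE d_gt0 X_compact s0 c1 D0
    mu_reg dD r_dom tS (lev_gt0 l) (lev_lt l) eta01.
    (* The exponent [lev l.+1] lies in the domain and below the critical exponent, so the series of
       singular values diverges there. *)
    apply: Phi_div => sumoo.
    have : (m <= (lev l.+1)%:E)%E.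
      by rewrite ge_min; apply/orP; left; apply: ereal_inf_lbound;
        exists (lev l.+1).
    by rewrite mE lee_fin leNgt lev_lt_m0.
  exists E; split => // w badw; apply: contrapT => nEw; apply: badw => t tl.
  exact: nE.
apply: filterS (ae_foralln lower) => w low.
apply/eqP; rewrite eq_le upper/= mE.
apply: le_ereal_inf_tmp => _ [t [t0 Ht] <-]; rewrite lee_fin leNgt.
(* With this [l] one has [m0 / l.+2%:R <= m0 - t], that is, [t <= lev l]. *)
apply/negP => tm; pose l := Num.trunc (m0 / (m0 - t)).
have tm0 : 0 < m0 - t by rewrite subr_gt0.
apply: (low l t) Ht; rewrite t0/= lerBrDr -lerBrDl.
rewrite ler_pdivrMr ?ltr0n// mulrC -ler_pdivrMr// ltW//.
by apply: lt_le_trans (truncnS_gt _) _; rewrite ler_nat.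
Qed.
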